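(* Let $(S,\|\cdot\|)$ be a complete $RN$ module over $C$ with base $(\Omega,\mathcal F,P)$. For a module homomorphism $A:D(A)\subset S\to S$ the following assertions are equivalent. (a) $(A,D(A))$ generates a contraction $C_{0}$--semigroup. (b) $(A,D(A))$ is closed, densely defined, and for each $\xi\in L^{0}_{++}(\mathcal F)$ one has $\xi\in\rho(A)$ and $\|\xi R(\xi,A)\|\leq 1$. (c) $(A,D(A))$ is closed, densely defined, and for each $\xi\in L^{0}(\mathcal F,C)$ with $\mathrm{Re}\,\xi\in L^{0}_{++}(\mathcal F)$ one has $\xi\in\rho(A)$ and $\|R(\xi,A)\|\leq\frac{1}{\mathrm{Re}\,\xi}$.
   Context: $(\Omega,\mathcal F,P)$ is a probability space; $L^{0}(\mathcal F,K)$ ($K=R$ or $C$) is the algebra of equivalence classes of $K$-valued $\mathcal F$-measurable random variables, ordered a.s.; $L^{0}_{+}(\mathcal F)=\{\xi\in L^0(\mathcal F,R):\xi\ge 0\}$, $L^{0}_{++}(\mathcal F)=\{\xi\in L^0(\mathcal F,R):\xi>0\text{ a.s.}\}$. An $RN$ module over $K$ with base $(\Omega,\mathcal F,P)$ is a left $L^0(\mathcal F,K)$-module $S$ with a map $\|\cdot\|:S\to L^0_+(\mathcal F)$ such that $\|\xi x\|=|\xi|\|x\|$, $\|x+y\|\le\|x\|+\|y\|$, $\|x\|=0\Rightarrow x=0$; it carries the $(\varepsilon,\lambda)$-topology, in which $x_n\to x$ iff $\|x_n-x\|\to0$ in probability; completeness refers to this topology. $B(S)$ is the set of continuous module homomorphisms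 $S\to S$, with $\|T\|=\bigwedge\{\xi\in L^0_+(\mathcal F):\|Tx\|\le\xi\|x\|\ \forall x\}$. A $C_0$--semigroup is $\{T(t):t\ge0\}\subset B(S)$ with $T(0)=I$, $T(s)T(t)=T(s+t)$, $\lim_{t\downarrow0}T(t)x=x$ for all $x$; it is a contraction $C_0$--semigroup if $\|T(t)\|\le1$ for all $t\ge0$. Its infinitesimal generator is $Ax=\lim_{t\downarrow0}\frac{T(t)x-x}{t}$ on $D(A)=\{x:\text{the limit exists}\}$; ''$(A,D(A))$ generates the semigroup'' means $A$ is its infinitesimal generator. $A$ is closed if its graph is closed in $S\times S$; densely defined if $D(A)$ is dense. $\rho(A)=\{\xi\in L^0(\mathcal F,C):\xi I-A:D(A)\to S\text{ is bijective and }(\xi I-A)^{-1}\in B(S)\}$, $R(\xi,A)=(\xi I-A)^{-1}$. *)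

(* Defs.v *)
From HB Require Import structures.
From mathcomp Require Import all_boot all_algebra.
From mathcomp Require Import all_classical all_reals all_analysis.
From mathcomp Require Import complex.
Set Implicit Arguments. Unset Strict Implicit. Unset Printing Implicit Defensive.
Import GRing.Theory Num.Theory.
Local Open Scope classical_set_scope.
Local Open Scope ring_scope.

Section RN.
Context (R : realType) (d : measure_display) (Ω : measurableType d)
        (P : probability Ω R).

(* Elements of L^0(F,C) are represented by F-measurable functions Ω -> C;
   all relations between them are taken P-almost surely, so that every
   notion below only depends on the equivalence classes. *)
Definition cmeas (f : Ω -> R[i]) :=
  measurable_fun setT (fun w => complex.Re (f w)) /\
  measurable_fun setT (fun w => complex.Im (f w)).

Definition rmeas (f : Ω -> R) := measurable_fun setT f.

Definition cabs (z : R[i]) : R := Normc.normc z.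

Definition ae (Q : Ω -> Prop) := {ae P, forall w, Q w}.

Record RNModule (S : zmodType) := {
  smul : (Ω -> R[i]) -> S -> S;
  rnorm : S -> Ω -> R;
  smul_ae : forall xi eta x, cmeas xi -> cmeas eta ->
              ae (fun w => xi w = eta w) -> smul xi x = smul eta x;
  smul1 : forall x, smul (fun _ => 1) x = x;
  smulA : forall xi eta x, cmeas xi -> cmeas eta ->
            smul xi (smul eta x) = smul (fun w => xi w * eta w) x;
  smulDl : forall xi eta x, cmeas xi -> cmeas eta ->
            smul (fun w => xi w + eta w) x = smul xi x + smul eta x;
  smulDr : forall xi x y, cmeas xi -> smul xi (x + y) = smul xi x + smul xi y;
  rnorm_meas : forall x, rmeas (rnorm x);
  rnorm_ge0 : forall x, ae (fun w => 0 <= rnorm x w);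
  rnormZ : forall xi x, cmeas xi ->
            ae (fun w => rnorm (smul xi x) w = cabs (xi w) * rnorm x w);
  rnormD : forall x y, ae (fun w => rnorm (x + y) w <= rnorm x w + rnorm y w);
  rnorm_eq0 : forall x, ae (fun w => rnorm x w = 0) -> x = 0
}.

Context (S : zmodType) (M : RNModule S).

Local Notation "xi *s x" := (smul M xi x) (at level 40).

Definition cst (c : R[i]) : Ω -> R[i] := fun _ => c.
Definition rC (xi : Ω -> R) : Ω -> R[i] := fun w => (xi w)%:C%C.

Definition nbhdEL (x : S) (eps lam : R) : set S :=
  [set y | ((1 - lam)%:E < P [set w | (rnorm M (y - x) w < eps)%R])%E].

Definition goodEL (eps lam : R) := 0 < eps /\ 0 < lam < 1.

Definition seq_cvg (u : nat -> S) (x : S) :=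
  forall eps lam, goodEL eps lam -> exists N, forall n, (N <= n)%N -> nbhdEL x eps lam (u n).

Definition lim_right0 (f : R -> S) (y : S) :=
  forall eps lam, goodEL eps lam ->
    exists2 delta, 0 < delta & forall t, 0 < t < delta -> nbhdEL y eps lam (f t).

(* completeness: every (ε,λ)-Cauchy sequence converges; the (ε,λ)-topology is
   metrizable, so this is completeness of the topology *)
Definition RNcomplete :=
  forall u : nat -> S,
    (forall eps lam, goodEL eps lam -> exists N, forall m n,
        (N <= m)%N -> (N <= n)%N -> nbhdEL (u m) eps lam (u n)) ->
    exists x, seq_cvg u x.

Definition submodule (D : set S) :=
  D 0 /\ (forall x y, D x -> D y -> D (x + y)) /\
  (forall xi x, cmeas xi -> D x -> D (xi *s x)).

Definition modhom_on (D : set S) (A : S -> S) :=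
  (forall x y, D x -> D y -> A (x + y) = A x + A y) /\
  (forall xi x, cmeas xi -> D x -> A (xi *s x) = xi *s A x).

Definition continuousEL (T : S -> S) :=
  forall x eps lam, goodEL eps lam -> exists eps' lam', goodEL eps' lam' /\
    forall y, nbhdEL x eps' lam' y -> nbhdEL (T x) eps lam (T y).

Definition bounded_op (T : S -> S) := modhom_on setT T /\ continuousEL T.

Definition opbound (T : S -> S) (xi : Ω -> R) :=
  rmeas xi /\ ae (fun w => 0 <= xi w) /\
  forall x, ae (fun w => rnorm M (T x) w <= xi w * rnorm M x w).

Definition is_opnorm (T : S -> S) (zeta : Ω -> R) :=
  rmeas zeta /\
  (forall xi, opbound T xi -> ae (fun w => zeta w <= xi w)) /\
  (forall z, rmeas z -> (forall xi, opbound T xi -> ae (fun w => z w <= xi w)) ->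
      ae (fun w => z w <= zeta w)).

Definition opnorm_le (T : S -> S) (eta : Ω -> R) :=
  exists zeta, is_opnorm T zeta /\ ae (fun w => zeta w <= eta w).

Definition C0_semigroup (T : R -> S -> S) :=
  (forall t, 0 <= t -> bounded_op (T t)) /\
  (forall x, T 0 x = x) /\
  (forall s t x, 0 <= s -> 0 <= t -> T s (T t x) = T (s + t) x) /\
  (forall x, lim_right0 (fun t => T t x) x).

Definition contraction_C0_semigroup (T : R -> S -> S) :=
  C0_semigroup T /\ forall t, 0 <= t -> opnorm_le (T t) (fun _ => 1).

Definition diff_quot (T : R -> S -> S) (x : S) : R -> S :=
  fun t => cst (t^-1)%:C%C *s (T t x - x).

Definition is_generator (T : R -> S -> S) (D : set S) (A : S -> S) :=
  (forall x, D x <-> exists y, lim_right0 (diff_quot T x) y) /\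
  (forall x, D x -> lim_right0 (diff_quot T x) (A x)).

Definition closed_op (D : set S) (A : S -> S) :=
  forall x y, ~ (D x /\ A x = y) ->
    exists eps lam, goodEL eps lam /\
      forall z, D z -> ~ (nbhdEL x eps lam z /\ nbhdEL y eps lam (A z)).

Definition RNdense (D : set S) :=
  forall x eps lam, goodEL eps lam -> exists z, D z /\ nbhdEL x eps lam z.

(* Rxi = R(ξ,A): the inverse of ξI - A : D(A) -> S, required to lie in B(S);
   ξ ∈ ρ(A) iff such an Rxi exists (it is then unique). *)
Definition is_resolvent (D : set S) (A : S -> S) (xi : Ω -> R[i]) (Rxi : S -> S) :=
  (forall x, D x -> Rxi (xi *s x - A x) = x) /\
  (forall y, D (Rxi y) /\ xi *s Rxi y - A (Rxi y) = y) /\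
  bounded_op Rxi.

End RN.

(* Main.v *)
(* A complete RN module is metrized by rho(|x - y|) with rho f = E(min(|f|, 1)),
   and every estimate below is an almost sure inequality between L^0-norms.

   From the semigroup to the resolvent: the difference quotients
   A_t = (T(t) - I) / t satisfy |xi x - A_t x| >= Re(xi) |x|, which passes to the
   generator.  Continuous S-valued functions need not be integrable in the
   (eps, lambda)-topology, so closedness and density of the generator are obtained
   from averages of T(kh) x after multiplying x by a random scalar that makes
   |x| <= 1/2; there rho no longer truncates, hence is convex on averages.  The
   equation xi x - A_h x = y is solved by a random contraction principle, and its
   solutions converge as h -> 0 when y lies in the domain, then for all y by
   density and closedness.

   From the resolvent to the semigroup: with J_h = (I - hA)^-1, the limit
   T(t) x = lim_j J_{2^-j}^{floor(2^j t)} x exists because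
   |J_{2k}^n x - J_k^{2n} x| <= n k^2 |A^2 x| on D(A^2), which is dense.  Its
   generator extends A and is injective after subtracting the identity, hence
   equals A. *)
Require Import Defs.
From HB Require Import structures.
From mathcomp Require Import all_boot all_order all_algebra.
From mathcomp Require Import all_classical all_reals all_analysis.
From mathcomp Require Import measurable_realfun complex ring lra.
Import Order.TTheory GRing.Theory Num.Theory.
Import numFieldNormedType.Exports.
Local Open Scope classical_set_scope.
Local Open Scope ring_scope.
Set Implicit Arguments.
Unset Strict Implicit.
Unset Printing Implicit Defensive.

(** [rho] is not convex. For n disjoint events of probability 1/n, the functions equal to n on the
    k-th event and 0 elsewhere have [rho] equal to 1/n each, while their average is the constant 1
    and has [rho] equal to 1. An average of points close to x may thus be far from x, and this is
    why averaging is preceded by a normalisation with an invertible random scalar.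

    Constants are random too: 1 / Re xi may be unbounded, so it is no Lipschitz constant for [rho],
    and a contraction ratio may come arbitrarily close to 1. Such factors g are cut at a level K,
    the event where |g| > K costing at most rho(g / K), which vanishes as K grows by dominated
    convergence.

    The approximation of the semigroup uses only powers of contractions, hence no exponential of an
    operator with random norm. Steps are halved because n k^2 with n k of order t is of order t k,
    which is summable along k = 2^-j. *)

(** * Equations in abelian groups by reflection *)

Inductive zexp := ZVar of nat | ZZero | ZAdd of zexp & zexp | ZOpp of zexp.

Fixpoint zeval (V : zmodType) (env : seq V) e : V :=
  match e with
  | ZVar i => nth 0 env i
  | ZZero => 0
  | ZAdd a b => zeval env a + zeval env b
  | ZOpp a => - zeval env a
  end.

Fixpoint zcoef e (i : nat) : int :=
  match e with
  | ZVar j => if i == j then 1 else 0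
  | ZZero => 0
  | ZAdd a b => zcoef a i + zcoef b i
  | ZOpp a => - zcoef a i
  end.

Lemma zevalE (V : zmodType) (env : seq V) e :
  zeval env e = \sum_(i < size env) nth 0 env i *~ zcoef e i.
Proof.
elim: e => [j| |a IHa b IHb|a IHa] /=.
- have [js|js] := ltnP j (size env); last first.
    (* An index beyond the list reads the default [0], and no [i] below the size equals it, so every
       coefficient vanishes. *)
    rewrite nth_default// big1// => i _; case: eqP => [ij|]; last by rewrite mulr0z.
    by move: (ltn_ord i); rewrite ij ltnNge js.
  rewrite (bigD1 (Ordinal js)) //= eqxx mulr1z big1 ?addr0// => i.
  by rewrite -val_eqE /= => /negbTE ->; rewrite mulr0z.
- by rewrite big1// => i _; rewrite mulr0z.
- by rewrite IHa IHb -big_split /=; apply: eq_bigr => i _; rewrite mulrzDr.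
- by rewrite IHa -sumrN; apply: eq_bigr => i _; rewrite mulrNz.
Qed.

(** The integer coefficients form a normal form, so comparing them is a closed boolean computation,
    which [zmod] discharges with [isT]. *)
Lemma zevalP (V : zmodType) (env : seq V) a b :
  all (fun i => zcoef a i == zcoef b i) (iota 0 (size env)) ->
  zeval env a = zeval env b.
Proof.
move=> /allP h; rewrite !zevalE; apply: eq_bigr => i _.
by rewrite (eqP (h i _))// mem_iota /= ltn_ord.
Qed.

Ltac zindex x env :=
  lazymatch env with
  | x :: _ => constr:(0%N)
  | _ :: ?l => let n := zindex x l in constr:(n.+1)
  end.

Ltac zinsert x env :=
  lazymatch env with
  | context [x :: _] => env
  | _ => constr:(x :: env)
  end.

Ltac zatoms env t :=
  lazymatch t with
  | (?a + ?b)%R => let env := zatoms env a in zatoms env b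
  | (- ?a)%R => zatoms env a
  | 0%R => env
  | _ => zinsert t env
  end.

Ltac zreify env t :=
  lazymatch t with
  | (?a + ?b)%R => let a := zreify env a in let b := zreify env b in
      constr:(ZAdd a b)
  | (- ?a)%R => let a := zreify env a in constr:(ZOpp a)
  | 0%R => constr:(ZZero)
  | _ => let n := zindex t env in constr:(ZVar n)
  end.

(* decides equations that hold in every abelian group *)
Ltac zmod :=
  lazymatch goal with
  | |- @eq ?V ?a ?b =>
      let env := zatoms (@nil V) a in
      let env := zatoms env b in
      let ea := zreify env a in
      let eb := zreify env b in
      exact: (@zevalP _ env ea eb isT)
  end.

(** * The metric E(min(|f|, 1)) of convergence in probability *)

Section convergence_in_probability.
Context (R : realType) (d : measure_display) (Ω : measurableType d)
        (P : probability Ω R).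
Implicit Types (f g h : Ω -> R).

#[global] Instance ae_filter : Filter (ae P).
Proof. exact: ae_filter_ringOfSetsType. Qed.

Lemma ae_and (Q Q' : Ω -> Prop) : ae P Q -> ae P Q' ->
  ae P (fun w => Q w /\ Q' w).
Proof. exact: filterI. Qed.

(** Inversion is continuous only away from 0, so the line is cut into that open set and the single
    point 0. *)
Lemma measurable_invr : measurable_fun [set: R] (fun x : R => x^-1).
Proof.
have mD : measurable [set x : R | x != 0].
  rewrite (_ : [set _ | _] = ~` [set 0]); first exact: measurableC.
  by apply/seteqP; split => x /= /eqP.
rewrite (_ : setT = [set x : R | x != 0] `|` [set 0]); last first.
  by apply/seteqP; split => x //= _; case: (eqVneq x 0); [right|left].
apply/measurable_funU => //; split.
  apply: open_continuous_measurable_fun.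
    exact: open_neq.
  by move=> x; rewrite inE /= => x0; exact: inv_continuous.
exact: measurable_fun_set1.
Qed.

Lemma rmeasV f : rmeas f -> rmeas (fun w => (f w)^-1).
Proof. by move=> mf; exact: (measurableT_comp measurable_invr mf). Qed.

Lemma rmeas_norm f : rmeas f -> rmeas (fun w => `|f w|).
Proof. by move=> mf; exact: measurableT_comp. Qed.

Let cap f w : R := Num.min `|f w| 1.

Definition rho f : R := fine (\int[P]_w (cap f w)%:E)%E.

Let cap_ge0 f w : 0 <= cap f w.
Proof. by rewrite /cap le_min normr_ge0 ler01. Qed.

Let cap_le1 f w : cap f w <= 1.
Proof. by rewrite /cap ge_min lexx orbT. Qed.

Let cap_meas f : rmeas f -> measurable_fun setT (fun w => (cap f w)%:E).
Proof.
move=> mf; apply/measurable_EFinP; apply: measurable_minr => //.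
exact: rmeas_norm.
Qed.

Lemma rhoE f : rmeas f -> (rho f)%:E = (\int[P]_w (cap f w)%:E)%E.
Proof.
move=> mf; rewrite fineK// ge0_fin_numE; last first.
  by apply: integral_ge0 => w _; rewrite lee_fin.
apply: (@le_lt_trans _ _ (\int[P]_w (cst 1%E w))%E); last first.
  by rewrite integral_cst//= mul1e probability_setT ltry.
apply: ge0_le_integral => //.
- by move=> w _; rewrite lee_fin.
- exact: cap_meas.
- by move=> w _; rewrite lee_fin.
Qed.

Lemma rho_ge0 f : 0 <= rho f.
Proof. by apply: fine_ge0; apply: integral_ge0 => w _; rewrite lee_fin. Qed.

Lemma rho_le f g : rmeas f -> rmeas g -> ae P (fun w => `|f w| <= `|g w|) ->
  rho f <= rho g.
Proof.
move=> mf mg fg; rewrite -lee_fin !rhoE//; apply: ae_ge0_le_integral => //.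
- by move=> w _; rewrite lee_fin.
- exact: cap_meas.
- by move=> w _; rewrite lee_fin.
- exact: cap_meas.
apply: filterS fg => w fg _; rewrite lee_fin /cap le_min !ge_min lexx orbT.
by rewrite fg.
Qed.

Lemma rho_le_add f g h : rmeas f -> rmeas g -> rmeas h ->
  ae P (fun w => `|f w| <= `|g w| + `|h w|) -> rho f <= rho g + rho h.
Proof.
move=> mf mg mh fgh; rewrite -lee_fin EFinD !rhoE//.
rewrite -ge0_integralD//; first last.
- exact: cap_meas.
- by move=> w _; rewrite lee_fin.
- exact: cap_meas.
- by move=> w _; rewrite lee_fin.
apply: ae_ge0_le_integral => //.
- by move=> w _; rewrite lee_fin.
- exact: cap_meas.
- by move=> w _; rewrite -EFinD lee_fin addr_ge0.
- by apply: emeasurable_funD; exact: cap_meas.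
apply: filterS fgh => w fgh _; rewrite -EFinD lee_fin /cap.
move: (normr_ge0 (f w)) (normr_ge0 (g w)) (normr_ge0 (h w)).
by case: (leP `|f w| 1); case: (leP `|g w| 1); case: (leP `|h w| 1); lra.
Qed.

(** The bound by 1 makes the truncation inactive, and [rho] is then a plain integral. This exact
    additivity serves the minimisation argument for essential infima. *)
Lemma rho_add f g : rmeas f -> rmeas g -> (forall w, 0 <= f w) ->
  (forall w, 0 <= g w) -> (forall w, f w + g w <= 1) ->
  rho (fun w => f w + g w) = rho f + rho g.
Proof.
move=> mf mg f0 g0 fg1; apply/EFin_inj; rewrite EFinD !rhoE//; last first.
  exact: measurable_funD.
rewrite -ge0_integralD//; first last.
- exact: cap_meas.
- by move=> w _; rewrite lee_fin.
- exact: cap_meas.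
- by move=> w _; rewrite lee_fin.
apply: eq_integral => w _; rewrite -EFinD /cap.
rewrite !ger0_norm ?addr_ge0//; congr (_%:E).
by move: (f0 w) (g0 w) (fg1 w); case: (leP (f w) 1); case: (leP (g w) 1);
  case: (leP (f w + g w) 1); lra.
Qed.

Lemma rho_eq0 f : rmeas f -> rho f = 0 -> ae P (fun w => f w = 0).
Proof.
move=> mf f0.
have : (\int[P]_w `|(cap f w)%:E| = 0)%E.
  rewrite -[0%E]/(0%:E) -f0 rhoE//; apply: eq_integral => w _.
  by rewrite gee0_abs// lee_fin.
move/(ae_eq_integral_abs P measurableT (cap_meas mf)).
apply: filterS => w /(_ I) [] /eqP; rewrite /cap => fw.
apply/normr0_eq0; case: (leP `|f w| 1) fw => [_ /eqP//|_].
by rewrite oner_eq0.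
Qed.

Lemma rho_cst c : rho (fun=> c) = Num.min `|c| 1.
Proof.
apply/EFin_inj; rewrite rhoE//; last exact: measurable_cst.
by rewrite /cap integral_cst//= probability_setT mule1.
Qed.

(** The inequality min(K a, 1) <= K min(a, 1) requires K >= 1. *)
Lemma rho_scale f g K : rmeas f -> rmeas g -> 1 <= K ->
  ae P (fun w => `|f w| <= K * `|g w|) -> rho f <= K * rho g.
Proof.
move=> mf mg K1 fg; rewrite -lee_fin EFinM !rhoE//.
have K0 : 0 <= K by lra.
rewrite -ge0_integralZl//; first last.
- by move=> w _; rewrite lee_fin.
- exact: cap_meas.
apply: ae_ge0_le_integral => //.
- by move=> w _; rewrite lee_fin.
- exact: cap_meas.
- by move=> w _; rewrite -EFinM lee_fin mulr_ge0.
- by apply: emeasurable_funM => //; exact: cap_meas.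
apply: filterS fg => w fg _; rewrite -EFinM lee_fin /cap.
by case: (leP `|f w| 1); case: (leP `|g w| 1); nra.
Qed.

(* Although [rho] truncates, it is convex on averages of functions bounded
   by [1]. *)
Lemma rho_avg (n : nat) (F : nat -> Ω -> R) f e : rmeas f ->
  (forall k, rmeas (F k)) -> (0 < n)%N ->
  ae P (fun w => forall k, `|F k w| <= 1) ->
  (forall k, (k < n)%N -> rho (F k) <= e) ->
  ae P (fun w => `|f w| <= n%:R^-1 * \sum_(k < n) `|F k w|) -> rho f <= e.
Proof.
move=> mf mF n0 F1 Fe fF.
have n0R : 0 < n%:R :> R by rewrite ltr0n.
have : ((rho f)%:E <= (n%:R^-1)%:E * \sum_(k < n) (rho (F k))%:E)%E.
  under eq_bigr do rewrite rhoE//.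
  rewrite -ge0_integral_sum//; first last.
  - by move=> k w _; rewrite lee_fin.
  - by move=> k; exact: cap_meas.
  rewrite -ge0_integralZl//; first last.
  - by move=> w _; apply: sume_ge0 => k _; rewrite lee_fin.
  - by apply: emeasurable_sum => k; exact: cap_meas.
  rewrite rhoE//; apply: ae_ge0_le_integral => //.
  - by move=> w _; rewrite lee_fin.
  - exact: cap_meas.
  - move=> w _; apply: mule_ge0; first by rewrite lee_fin invr_ge0 ltW.
    by apply: sume_ge0 => k _; rewrite lee_fin.
  - apply: emeasurable_funM => //.
    by apply: emeasurable_sum => k; exact: cap_meas.
  apply: filterS2 F1 fF => w F1 fF _; rewrite sumEFin -EFinM lee_fin.
  apply: le_trans (le_trans _ fF) _; first by rewrite /cap ge_min lexx.
  rewrite ler_wpM2l ?invr_ge0 ?(ltW n0R)//; apply: ler_sum => k _.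
  (* The bound by 1 enters here: min(|F k|, 1) equals |F k|, so no truncation intervenes between the
     average and its terms. *)
  by rewrite /cap le_min lexx F1.
rewrite sumEFin -EFinM lee_fin => /le_trans; apply.
rewrite ler_pdivrMl// mulr_natl -[X in _ *+ X]card_ord -sumr_const.
by apply: ler_sum => k _; exact: Fe.
Qed.

Lemma rho_cvg0 (F : nat -> Ω -> R) : (forall n, rmeas (F n)) ->
  ae P (fun w => F n w @[n --> \oo] --> (0 : R)) ->
  rho (F n) @[n --> \oo] --> (0 : R).
Proof.
move=> mF cF; apply: fine_cvg.
have := @dominated_convergence _ _ _ P setT measurableT
  (fun n w => (cap (F n) w)%:E) (cst 0%E) (cst 1%E).
case=> //.
- by move=> n; exact: cap_meas.
- apply: filterS cF => w cF _; apply: cvg_EFin; first by near=> n.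
  apply: (@squeeze_cvgr _ _ _ _ (fun=> 0) (fun n => `|F n w|)).
  + by near=> n; rewrite cap_ge0 /cap ge_min lexx.
  + exact: cvg_cst.
  + by rewrite -[X in _ --> X](normr0 R); exact: cvg_norm.
- apply/integrableP; split => //.
  under eq_integral do rewrite /= normr1.
  by rewrite integral_cst//= probability_setT mule1 ltry.
- apply: aeW => w n _; rewrite gee0_abs ?lee_fin//.
move=> _ _; rewrite integral0; exact.
Unshelve. all: by end_near.
Qed.

(** Levels above 1 are excluded because the truncated function never exceeds 1. *)
Lemma rho_markov f e : rmeas f -> 0 < e <= 1 ->
  (P [set w | e <= `|f w|]%R <= (rho f / e)%:E)%E.
Proof.
move=> mf /andP[e0 e1].
have mA : measurable [set w | e <= `|f w|].
  rewrite -[X in measurable X]setTI.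
  by apply: measurable_fun_le => //; exact: rmeas_norm.
rewrite mulrC EFinM lee_pdivlMl// rhoE//.
rewrite -[X in (_ * P X)%E]setIT -integral_indic//.
rewrite -ge0_integralZl//; last by rewrite lee_fin ltW.
  apply: ge0_le_integral => //.
  - by move=> w _; rewrite mule_ge0// lee_fin ltW.
  - apply: emeasurable_funM => //; apply/measurable_EFinP.
    exact: measurable_indic.
  - exact: cap_meas.
  move=> w _; rewrite -EFinM lee_fin indicE.
  case: (boolP (w \in _)); rewrite ?inE /= => wA; last by rewrite mulr0.
  by rewrite mulr1 /cap le_min wA.
by apply/measurable_EFinP; exact: measurable_indic.
Qed.

Lemma rho_le_prob f e : rmeas f -> 0 < e ->
  ((rho f)%:E <= e%:E + P [set w | e <= `|f w|]%R)%E.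
Proof.
move=> mf e0.
have mA : measurable [set w | e <= `|f w|].
  rewrite -[X in measurable X]setTI.
  by apply: measurable_fun_le => //; exact: rmeas_norm.
rewrite rhoE// -[X in (_ + P X)%E]setIT -integral_indic//.
rewrite -[e%:E]mule1 -(@probability_setT _ _ _ P) -integral_cst//.
rewrite -ge0_integralD//; first last.
- by apply/measurable_EFinP; exact: measurable_indic.
- by move=> w _; rewrite lee_fin ltW.
apply: ge0_le_integral => //.
- by move=> w _; rewrite lee_fin.
- exact: cap_meas.
- apply: emeasurable_funD => //; apply/measurable_EFinP.
  exact: measurable_indic.
move=> w _; rewrite -EFinD lee_fin indicE.
case: (boolP (w \in _)); rewrite ?inE /= => wA.
  by rewrite (le_trans (cap_le1 _ _))// lerDr ltW.
move: wA; rewrite notin_setE /= => /negP; rewrite -ltNge => /ltW fe.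
by rewrite addr0 /cap ge_min fe.
Qed.


(** Where |g| <= K the product is at most K |h|; elsewhere the truncated integrand is at most 1 =
    min(|g / K|, 1). The second term tends to 0 as K grows, by [rho_div_cvg0]. *)
Lemma rho_mul f g h K : rmeas f -> rmeas g -> rmeas h -> 1 <= K ->
  ae P (fun w => `|f w| <= `|g w| * `|h w|) ->
  rho f <= K * rho h + rho (fun w => g w / K).
Proof.
move=> mf mg mh K1 fgh; have K0 : 0 < K by lra.
have mgK : rmeas (fun w => g w / K) by exact: measurable_funM.
have mKh : rmeas (fun w => K * h w) by exact: measurable_funM.
rewrite -lerBlDr.
apply: (@le_trans _ _ (rho (fun w => K * h w))); last first.
  apply: rho_scale => //.
  by apply: aeW => w; rewrite normrM gtr0_norm.
rewrite lerBlDr -lee_fin EFinD !rhoE//.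
rewrite -ge0_integralD//; first last.
- exact: cap_meas.
- by move=> w _; rewrite lee_fin.
- exact: cap_meas.
- by move=> w _; rewrite lee_fin.
apply: ae_ge0_le_integral => //.
- by move=> w _; rewrite lee_fin.
- exact: cap_meas.
- by move=> w _; rewrite -EFinD lee_fin addr_ge0.
- by apply: emeasurable_funD; exact: cap_meas.
apply: filterS fgh => w fgh _; rewrite -EFinD lee_fin.
have [gK|gK] := leP `|g w| K.
  apply: (@le_trans _ _ (cap (fun w => K * h w) w)); last by rewrite lerDl.
  rewrite /cap le_min ge_min [X in _ && X]ge_min lexx orbT andbT.
  rewrite (le_trans fgh)//.
  by rewrite normrM (gtr0_norm K0) ler_wpM2r.
rewrite (le_trans (cap_le1 _ _))// [cap (fun w => g w / K) w]/cap.
rewrite min_r ?lerDr// normf_div (gtr0_norm K0) ler_pdivlMr// mul1r.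
exact: ltW.
Qed.

Lemma rho_div_cvg0 g : rmeas g ->
  rho (fun w => g w / n.+1%:R) @[n --> \oo] --> (0 : R).
Proof.
move=> mg; apply: rho_cvg0; first by move=> n; exact: measurable_funM.
apply: aeW => w; rewrite -[X in _ --> X](mulr0 (g w)).
by apply: cvgM; [exact: cvg_cst|exact: cvg_harmonic].
Qed.

End convergence_in_probability.

(** * Convergence to 0 in probability along a filter *)

Section random_limits.
Context (R : realType) (d : measure_display) (Ω : measurableType d)
        (P : probability Ω R) (I : Type) (F : set_system I) {FF : Filter F}.
Implicit Types (f g h : I -> Ω -> R).
Local Notation rho := (rho P).

Definition rcvg0 f := rho (f i) @[i --> F] --> (0 : R).

Lemma rcvg0_squeeze f (a : I -> R) : (\forall i \near F, rho (f i) <= a i) ->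
  a i @[i --> F] --> (0 : R) -> rcvg0 f.
Proof.
move=> fa a0; apply: (@squeeze_cvgr _ _ _ _ (fun=> 0) a) => //.
  by apply: filterS fa => i ->; rewrite rho_ge0.
exact: cvg_cst.
Qed.

Lemma rcvg0_le_add f g h : (forall i, rmeas (f i)) -> (forall i, rmeas (g i)) ->
  (forall i, rmeas (h i)) ->
  (\forall i \near F, ae P (fun w => `|f i w| <= `|g i w| + `|h i w|)) ->
  rcvg0 g -> rcvg0 h -> rcvg0 f.
Proof.
move=> mf mg mh fgh g0 h0.
apply: (@rcvg0_squeeze _ (fun i => rho (g i) + rho (h i))).
  by apply: filterS fgh => i; exact: rho_le_add.
by rewrite -[X in _ --> X]addr0; exact: cvgD.
Qed.

(** The cut-off level for [g] is fixed first, and only then the index is chosen so that [h] is small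
    compared with that level. *)
Lemma rcvg0_mul f (g : Ω -> R) h : (forall i, rmeas (f i)) -> rmeas g ->
  (forall i, rmeas (h i)) ->
  (\forall i \near F, ae P (fun w => `|f i w| <= `|g w| * `|h i w|)) ->
  rcvg0 h -> rcvg0 f.
Proof.
move=> mf mg mh fgh h0; apply/cvgr0Pnorm_lt => e e0.
have [n _ /(_ n (leqnn _)) /= gn] :
    \forall n \near \oo, rho (fun w => g w / n.+1%:R) < e / 2.
  have /cvgr0Pnorm_lt/(_ (e / 2)) := rho_div_cvg0 P mg.
  rewrite divr_gt0// => /(_ isT); apply: filterS => n.
  by rewrite ger0_norm ?rho_ge0.
have : \forall i \near F, rho (h i) < e / 2 / n.+1%:R.
  have /cvgr0Pnorm_lt/(_ (e / 2 / n.+1%:R)) := h0.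
  rewrite !divr_gt0// => /(_ isT); apply: filterS => i.
  by rewrite ger0_norm ?rho_ge0.
apply: filterS2 fgh => i fgh hi; rewrite ger0_norm ?rho_ge0//.
have n1 : 1 <= n.+1%:R :> R by rewrite ler1n.
have := rho_mul (mf i) mg (mh i) n1 fgh.
move: hi; rewrite ltr_pdivlMr// mulrC => hi.
by move/le_lt_trans; apply; lra.
Qed.

Lemma rcvg0_const (a : I -> R) : a i @[i --> F] --> (0 : R) ->
  rcvg0 (fun i _ => a i).
Proof.
move=> a0; apply: (@rcvg0_squeeze _ (fun i => `|a i|)).
  by near=> i; rewrite rho_cst ge_min lexx.
by rewrite -[X in _ --> X](normr0 R); exact: cvg_norm.
Unshelve. all: by end_near.
Qed.

End random_limits.

(** The exceptional null set depends on the index, and uncountably many of them cannot be united.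
    Comparing [rho] of the positive part of [f] with [rho (g i)] avoids this. *)
Lemma ae_le0_lim (R : realType) (d : measure_display) (Ω : measurableType d)
    (P : probability Ω R) (I : Type) (F : set_system I) {FF : ProperFilter F}
    (f : Ω -> R) (g : I -> Ω -> R) : rmeas f -> (forall i, rmeas (g i)) ->
  (\forall i \near F, ae P (fun w => f w <= `|g i w|)) -> rcvg0 P F g ->
  ae P (fun w => f w <= 0).
Proof.
move=> mf mg fg g0; pose h w := Num.max (f w) 0.
have mh : rmeas h by apply: measurable_maxr => //; exact: measurable_cst.
suff : rho P h = 0.
  move/(rho_eq0 mh); apply: filterS => w; rewrite /h => <-.
  by rewrite le_max lexx.
apply/eqP; rewrite eq_le rho_ge0 andbT; apply: (cvgr_to_ge g0).
apply: filterS fg => i fg; apply: rho_le => //.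
apply: filterS fg => w; rewrite /h.
by case: (leP (f w) 0) => ? ?; rewrite ?normr0 ?normr_ge0// gtr0_norm.
Qed.

(** * Complex random variables and the modulus *)

Section complex_random_variables.
Context (R : realType) (d : measure_display) (Ω : measurableType d).
Implicit Types (xi eta : Ω -> R[i]).

Lemma cmeas_cst (c : R[i]) : cmeas (cst c : Ω -> R[i]).
Proof. by split; exact: measurable_cst. Qed.

Lemma cmeas_rC (f : Ω -> R) : rmeas f -> cmeas (rC f).
Proof. by move=> mf; split => //; exact: measurable_cst. Qed.

Lemma ReD (x y : R[i]) : complex.Re (x + y) = complex.Re x + complex.Re y.
Proof. by case: x y => [a b] [a' b']. Qed.

Lemma ImD (x y : R[i]) : complex.Im (x + y) = complex.Im x + complex.Im y.
Proof. by case: x y => [a b] [a' b']. Qed.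

Lemma cmeasD xi eta : cmeas xi -> cmeas eta -> cmeas (fun w => xi w + eta w).
Proof.
move=> [m1 m2] [m3 m4]; split.
  by under [X in measurable_fun _ X]eq_fun do rewrite ReD; exact: measurable_funD.
by under [X in measurable_fun _ X]eq_fun do rewrite ImD; exact: measurable_funD.
Qed.

Lemma cmeasM xi eta : cmeas xi -> cmeas eta -> cmeas (fun w => xi w * eta w).
Proof.
move=> [m1 m2] [m3 m4]; split.
  rewrite (_ : (fun w => _) = fun w => complex.Re (xi w) * complex.Re (eta w)
      - complex.Im (xi w) * complex.Im (eta w)); last first.
    by apply/funext => w; case: (xi w) (eta w) => [a b] [a' b'].
  by apply: measurable_funB; exact: measurable_funM.
rewrite (_ : (fun w => _) = fun w => complex.Re (xi w) * complex.Im (eta w)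
    + complex.Im (xi w) * complex.Re (eta w)); last first.
  by apply/funext => w; case: (xi w) (eta w) => [a b] [a' b'].
by apply: measurable_funD; exact: measurable_funM.
Qed.

Lemma cmeasV xi : cmeas xi -> cmeas (fun w => (xi w)^-1).
Proof.
move=> [m1 m2].
have mn : rmeas (fun w => (complex.Re (xi w) ^+ 2 + complex.Im (xi w) ^+ 2)^-1).
  by apply: rmeasV; apply: measurable_funD; exact: measurable_funX.
split.
  rewrite (_ : (fun w => _) = fun w => complex.Re (xi w) *
      (complex.Re (xi w) ^+ 2 + complex.Im (xi w) ^+ 2)^-1); last first.
    by apply/funext => w; case: (xi w) => [a b].
  exact: measurable_funM.
rewrite (_ : (fun w => _) = fun w => - (complex.Im (xi w) *
    (complex.Re (xi w) ^+ 2 + complex.Im (xi w) ^+ 2)^-1)); last first.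
  by apply/funext => w; case: (xi w) => [a b].
by apply: measurableT_comp => //; exact: measurable_funM.
Qed.

Lemma rmeas_cabs xi : cmeas xi -> rmeas (fun w => cabs (xi w)).
Proof.
move=> [m1 m2].
rewrite /rmeas (_ : (fun w => _) = Num.sqrt \o
    (fun w => complex.Re (xi w) ^+ 2 + complex.Im (xi w) ^+ 2)); last first.
  by apply/funext => w; rewrite /cabs/=; case: (xi w).
apply: measurableT_comp.
  by apply: continuous_measurable_fun; exact: sqrt_continuous.
by apply: measurable_funD; exact: measurable_funX.
Qed.

Lemma cabs_ge0 (z : R[i]) : 0 <= cabs z.
Proof. by rewrite /cabs; case: z => a b; exact: sqrtr_ge0. Qed.

Lemma cabsR (a : R) : cabs a%:C%C = `|a|.
Proof. by rewrite /cabs /= expr0n /= addr0 sqrtr_sqr. Qed.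

Lemma cabs_eq0 (z : R[i]) : (cabs z == 0) = (z == 0).
Proof.
apply/eqP/eqP => [/Normc.eq0_normc//|->].
by rewrite /cabs Normc.normc0.
Qed.

Lemma cabsV (x : R[i]) : cabs x^-1 = (cabs x)^-1.
Proof. exact: Normc.normcV. Qed.

Lemma Re_le_cabs (z : R[i]) : complex.Re z <= cabs z.
Proof.
rewrite /cabs; case: z => a b /=; apply: le_trans (ler_norm a) _.
by rewrite -sqrtr_sqr ler_wsqrtr// lerDl sqr_ge0.
Qed.

End complex_random_variables.

Lemma measurable_lt (R : realType) (d : measure_display) (Ω : measurableType d)
  (f : Ω -> R) (e : R) : rmeas f -> measurable [set w | f w < e].
Proof.
move=> mf; rewrite (_ : [set w | _] = ~` [set w | e <= f w]).
  apply: measurableC; rewrite -[X in measurable X]setTI.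
  exact: measurable_fun_le.
by apply/seteqP; split => w /=; rewrite ltNge => /negP.
Qed.

(** * Algebra and metric of an RN module *)

Section RN_modules.
Context (R : realType) (d : measure_display) (Ω : measurableType d)
        (P : probability Ω R) (S : zmodType) (M : RNModule P S).
Local Notation nrm := (rnorm M).
Local Notation "xi *s x" := (smul M xi x) (at level 40).
Implicit Types (x y z : S) (xi eta : Ω -> R[i]) (t : R).

Definition rscale t x := cst t%:C%C *s x.
Local Notation "t *r x" := (rscale t x) (at level 40).

Lemma smul0l x : (fun=> 0) *s x = 0.
Proof.
apply: (@addrI _ ((fun=> 0) *s x)); rewrite addr0 -smulDl; try exact: cmeas_cst.
by under [X in smul _ X]eq_fun do rewrite addr0.
Qed.

Lemma smul0r xi : cmeas xi -> xi *s 0 = 0.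
Proof. by move=> m; apply: (@addrI _ (xi *s 0)); rewrite -smulDr// !addr0. Qed.

Lemma smulNr xi x : cmeas xi -> xi *s (- x) = - (xi *s x).
Proof.
by move=> m; apply/eqP; rewrite -addr_eq0 -smulDr// addNr smul0r.
Qed.

Lemma smulBr xi x y : cmeas xi -> xi *s (x - y) = xi *s x - xi *s y.
Proof. by move=> m; rewrite smulDr// smulNr. Qed.

Lemma smulC xi eta x : cmeas xi -> cmeas eta ->
  xi *s (eta *s x) = eta *s (xi *s x).
Proof.
by move=> m1 m2; rewrite !smulA//; congr smul; apply/funext => w; rewrite mulrC.
Qed.

Lemma rscale1 x : 1 *r x = x.
Proof. exact: smul1. Qed.

Lemma rscale0 x : 0 *r x = 0.
Proof. exact: smul0l. Qed.

Lemma rscaleA s t x : s *r (t *r x) = (s * t) *r x.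
Proof.
rewrite /rscale smulA; try exact: cmeas_cst.
by congr smul; apply/funext => w; rewrite /cst rmorphM.
Qed.

Lemma rscaleDl s t x : (s + t) *r x = s *r x + t *r x.
Proof.
rewrite /rscale -smulDl; try exact: cmeas_cst.
by congr smul; apply/funext => w; rewrite /cst rmorphD.
Qed.

Lemma rscaleDr t x y : t *r (x + y) = t *r x + t *r y.
Proof. exact/smulDr/cmeas_cst. Qed.

Lemma rscaler0 t : t *r 0 = 0.
Proof. exact/smul0r/cmeas_cst. Qed.

Lemma rscalerN t x : t *r (- x) = - (t *r x).
Proof. exact/smulNr/cmeas_cst. Qed.

Lemma rscaleBr t x y : t *r (x - y) = t *r x - t *r y.
Proof. by rewrite rscaleDr rscalerN. Qed.

Lemma rscaleNl t x : (- t) *r x = - (t *r x).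
Proof. by apply/eqP; rewrite -addr_eq0 -rscaleDl addNr rscale0. Qed.

Lemma rscaleBl s t x : (s - t) *r x = s *r x - t *r x.
Proof. by rewrite rscaleDl rscaleNl. Qed.

Lemma rscale_sum t (n : nat) (u : nat -> S) :
  t *r (\sum_(k < n) u k) = \sum_(k < n) t *r u k.
Proof.
elim: n => [|n IH]; first by rewrite !big_ord0 rscaler0.
by rewrite !big_ord_recr /= rscaleDr IH.
Qed.

Lemma smul_rscale xi t x : cmeas xi -> xi *s (t *r x) = t *r (xi *s x).
Proof. by move=> m; apply: smulC => //; exact: cmeas_cst. Qed.

Lemma sumr_rscale (n : nat) x : \sum_(k < n) x = n%:R *r x.
Proof.
elim: n => [|n IH]; first by rewrite big_ord0 rscale0.
by rewrite big_ord_recr /= IH -[in RHS]addn1 natrD rscaleDl rscale1.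
Qed.

Lemma nrm_rscale t x : ae P (fun w => nrm (t *r x) w = `|t| * nrm x w).
Proof.
have := rnormZ M x (@cmeas_cst R d Ω t%:C%C); apply: filterS => w ->.
by rewrite /cst cabsR.
Qed.

Lemma nrm0 : ae P (fun w => nrm 0 w = 0).
Proof.
by rewrite -(rscale0 0); apply: filterS (nrm_rscale 0 0) => w ->; rewrite normr0 mul0r.
Qed.

Lemma nrmN x : ae P (fun w => nrm (- x) w = nrm x w).
Proof.
rewrite -[x in - x]rscale1 -rscaleNl.
by apply: filterS (nrm_rscale (-1) x) => w ->; rewrite normrN normr1 mul1r.
Qed.

Lemma nrm_distC x y : ae P (fun w => nrm (x - y) w = nrm (y - x) w).
Proof. by rewrite -opprB; exact: nrmN. Qed.

Lemma nrmB x y : ae P (fun w => nrm (x - y) w <= nrm x w + nrm y w).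
Proof. by apply: filterS2 (rnormD M x (- y)) (nrmN y) => w + <-. Qed.

Lemma nrm_le_dist x y : ae P (fun w => nrm x w <= nrm y w + nrm (x - y) w).
Proof. by have := rnormD M y (x - y); rewrite addrC subrK. Qed.

Lemma nrm_dist_tri z x y :
  ae P (fun w => nrm (x - y) w <= nrm (x - z) w + nrm (z - y) w).
Proof. by have := rnormD M (x - z) (z - y); rewrite addrA subrK. Qed.

Lemma nrm_sum (n : nat) (u : nat -> S) :
  ae P (fun w => nrm (\sum_(k < n) u k) w <= \sum_(k < n) nrm (u k) w).
Proof.
elim: n => [|n IH].
  by apply: filterS nrm0 => w e; rewrite !big_ord0 e.
rewrite big_ord_recr /=.
apply: filterS2 (rnormD M (\sum_(k < n) u k) (u n)) IH => w h1 h2.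
by rewrite big_ord_recr /= (le_trans h1)// lerD2r.
Qed.

Definition rdist x := rho P (nrm x).

Lemma rdist_ge0 x : 0 <= rdist x. Proof. exact: rho_ge0. Qed.

Lemma rdist_le x y : ae P (fun w => nrm x w <= nrm y w) -> rdist x <= rdist y.
Proof.
move=> xy; apply: rho_le; try exact: rnorm_meas.
by apply: filterS3 xy (rnorm_ge0 M x) (rnorm_ge0 M y) => w ? ? ?; rewrite !ger0_norm.
Qed.

Lemma rdistD x y : rdist (x + y) <= rdist x + rdist y.
Proof.
apply: rho_le_add; try exact: rnorm_meas.
apply: filterS2 (rnormD M x y) (rnorm_ge0 M (x + y)) => w h ?.
by rewrite ger0_norm// (le_trans h)// lerD// ler_norm.
Qed.

Lemma rdistN x : rdist (- x) = rdist x.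
Proof.
apply/eqP; rewrite eq_le; apply/andP; split; apply: rdist_le.
  by apply: filterS (nrmN x) => w ->.
by apply: filterS (nrmN x) => w ->.
Qed.

Lemma rdistC x y : rdist (x - y) = rdist (y - x).
Proof. by rewrite -opprB rdistN. Qed.

Lemma rdist_tri z x y : rdist (x - y) <= rdist (x - z) + rdist (z - y).
Proof. by have := rdistD (x - z) (z - y); rewrite addrA subrK. Qed.

Lemma rdist0 : rdist 0 = 0.
Proof.
apply/eqP; rewrite eq_le rdist_ge0 andbT.
have := rho_cst P (0 : R); rewrite normr0 min_l// => <-; apply: rho_le.
- exact: rnorm_meas.
- exact: measurable_cst.
by apply: filterS nrm0 => w ->.
Qed.

Lemma rdist_eq0 x : rdist x = 0 -> x = 0.
Proof. by move/(rho_eq0 (rnorm_meas M x)); exact: rnorm_eq0. Qed.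

(** Markov's inequality at level min(eps, 1), the minimum being forced by the truncation. *)
Lemma rdist_lt_nbhd x y eps lam : goodEL eps lam ->
  rdist (y - x) < lam * Num.min eps 1 -> nbhdEL M x eps lam y.
Proof.
move=> [e0 /andP[l0 l1]] h; rewrite /nbhdEL /=.
have mA := measurable_lt eps (rnorm_meas M (y - x)).
rewrite -[X in P X]setCK probability_setC; last exact: measurableC.
have m0 : 0 < Num.min eps 1 <= 1 by rewrite lt_min e0 ltr01 ge_min lexx orbT.
have hM := rho_markov P (rnorm_meas M (y - x)) m0.
have : (P (~` [set w | (nrm (y - x) w < eps)%R]) < lam%:E)%E.
  apply: (@le_lt_trans _ _ (P [set w | (Num.min eps 1 <= `|nrm (y - x) w|)%R])).
    apply: le_measure; rewrite ?inE//; first exact: measurableC.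
      rewrite -[X in measurable X]setTI.
      apply: measurable_fun_le => //; apply: rmeas_norm; exact: rnorm_meas.
    move=> w /= /negP; rewrite -leNgt => ew.
    by rewrite ge_min (le_trans ew)// ler_norm.
  apply: le_lt_trans hM _; rewrite lte_fin ltr_pdivrMr//.
  by case/andP: m0.
case: (P _) => [p| |]//; rewrite ?lte_fin => pl; last by rewrite ltry.
by lra.
Qed.

Lemma nbhd_rdist_le x y e : goodEL e e -> nbhdEL M x e e y ->
  rdist (y - x) <= 2 * e.
Proof.
move=> [e0 _]; rewrite /nbhdEL /= => h.
have mA := measurable_lt e (rnorm_meas M (y - x)).
(* The L^0-norm is nonnegative only almost surely. Its positive part makes {e <= |g|} exactly the
   complement of {norm < e}; the factor 2 then collects e from the level and e from the
   probability. *)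
pose g w := Num.max (nrm (y - x) w) 0.
have mg : rmeas g.
  apply: measurable_maxr; first exact: rnorm_meas.
  exact: measurable_cst.
apply: (@le_trans _ _ (rho P g)).
  apply: rho_le => //; first exact: rnorm_meas.
  by apply: filterS (rnorm_ge0 M (y - x)) => w h0; rewrite /g max_l.
have := rho_le_prob P mg e0.
rewrite (_ : [set w | _] = ~` [set w | (nrm (y - x) w < e)%R]); last first.
  apply/seteqP; split => w /=.
    move=> h1 h2; move: h1; rewrite /g; case: (leP (nrm (y - x) w) 0) => ?.
      by rewrite normr0; lra.
    by rewrite gtr0_norm//; lra.
  move/negP; rewrite -leNgt => h1; rewrite /g max_l; last by lra.
  by rewrite ger0_norm//; lra.
rewrite probability_setC//.
move: h; case: (P _) => [p| |]//; rewrite ?lte_fin => pl.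
by rewrite -EFinB -EFinD lee_fin; lra.
Qed.

End RN_modules.

(** * Limits and completeness in an RN module *)

Section RN_limits.
Context (R : realType) (d : measure_display) (Ω : measurableType d)
        (P : probability Ω R) (S : zmodType) (M : RNModule P S).
Local Notation nrm := (rnorm M).
Local Notation "xi *s x" := (smul M xi x) (at level 40).
Local Notation "t *r x" := (rscale M t x) (at level 40).
Local Notation rdist := (rdist M).
Implicit Types (x y z : S) (xi eta : Ω -> R[i]) (t : R).

Definition rlim (I : Type) (F : set_system I) (u : I -> S) x :=
  rdist (u i - x) @[i --> F] --> (0 : R).

Section filter.
Context (I : Type) (F : set_system I) {FF : Filter F}.
Implicit Types (u v : I -> S).

Lemma rlimP u x :
  rlim F u x <-> forall e, 0 < e -> \forall i \near F, rdist (u i - x) < e.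
Proof.
split=> [/cvgr0Pnorm_lt h e e0|h].
  by apply: filterS (h e e0) => i; rewrite ger0_norm ?rdist_ge0.
apply/cvgr0Pnorm_lt => e e0.
by apply: filterS (h e e0) => i; rewrite ger0_norm ?rdist_ge0.
Qed.

Lemma rlim_nbhd u x : rlim F u x <-> (forall eps lam, goodEL eps lam ->
  \forall i \near F, nbhdEL M x eps lam (u i)).
Proof.
split=> [/rlimP h eps lam g|h].
  have [e0 /andP[l0 l1]] := g.
  have : 0 < lam * Num.min eps 1 by rewrite mulr_gt0// lt_min e0 ltr01.
  by move/h; apply: filterS => i; exact: rdist_lt_nbhd.
apply/rlimP => e e0; pose e' := Num.min (e / 3) (1 / 2).
have g : goodEL e' e'.
  rewrite /e'; case: (leP (e / 3) (1 / 2)) => ?; split; rewrite ?divr_gt0//=;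
    lra.
apply: filterS (h _ _ g) => i /(nbhd_rdist_le g) /le_lt_trans; apply.
have : e' <= e / 3 by rewrite ge_min lexx.
by lra.
Qed.

Lemma rlim_squeeze u x (a : I -> R) :
  (\forall i \near F, rdist (u i - x) <= a i) -> a i @[i --> F] --> (0 : R) ->
  rlim F u x.
Proof. exact: rcvg0_squeeze. Qed.

Lemma rlim_cst x : rlim F (fun=> x) x.
Proof. by rewrite /rlim subrr rdist0; exact: cvg_cst. Qed.

Lemma rlim_eq u v x : (\forall i \near F, u i = v i) -> rlim F u x ->
  rlim F v x.
Proof.
by move=> uv /rlimP ux; apply/rlimP => e /ux; apply: filterS2 uv => i ->.
Qed.

Lemma rlimD u v x y : rlim F u x -> rlim F v y ->
  rlim F (fun i => u i + v i) (x + y).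
Proof.
move=> ux vy; apply: (@rlim_squeeze _ _ (fun i => rdist (u i - x) + rdist (v i - y))).
  by apply: nearW => i; rewrite opprD addrACA; exact: rdistD.
by rewrite -[X in _ --> X]addr0; exact: cvgD.
Qed.

Lemma rlim_bound u v x y (c : Ω -> R) : rmeas c ->
  (\forall i \near F, ae P (fun w => nrm (v i - y) w <= c w * nrm (u i - x) w)) ->
  rlim F u x -> rlim F v y.
Proof.
move=> mc h ux.
apply: (@rcvg0_mul R d Ω P I F FF (fun i => nrm (v i - y)) c
  (fun i => nrm (u i - x))) => //; try by move=> i; exact: rnorm_meas.
apply: filterS h => i.
apply: filterS3 (rnorm_ge0 M (v i - y)) (rnorm_ge0 M (u i - x)) => w p q h.
rewrite ger0_norm// (ger0_norm q) (le_trans h)//.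
by rewrite ler_wpM2r// ler_norm.
Qed.

Lemma rlim_le u v x y :
  (\forall i \near F, ae P (fun w => nrm (v i - y) w <= nrm (u i - x) w)) ->
  rlim F u x -> rlim F v y.
Proof.
move=> h; apply: (@rlim_bound _ _ _ _ (fun=> 1)); first exact: measurable_cst.
by apply: filterS h => i; apply: filterS => w; rewrite mul1r.
Qed.

Lemma rlimN u x : rlim F u x -> rlim F (fun i => - u i) (- x).
Proof.
apply: rlim_le; apply: nearW => i; rewrite -opprD.
by apply: filterS (nrmN M (u i - x)) => w ->.
Qed.

Lemma rlimB u v x y : rlim F u x -> rlim F v y ->
  rlim F (fun i => u i - v i) (x - y).
Proof. by move=> ux vy; apply: rlimD => //; exact: rlimN. Qed.

Lemma rlimZ xi u x : cmeas xi -> rlim F u x ->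
  rlim F (fun i => xi *s u i) (xi *s x).
Proof.
move=> m; apply: (rlim_bound (rmeas_cabs m)).
apply: nearW => i; rewrite -smulBr//.
by apply: filterS (rnormZ M (u i - x) m) => w ->.
Qed.

Lemma rlim_rscale t u x : rlim F u x -> rlim F (fun i => t *r u i) (t *r x).
Proof. exact/rlimZ/cmeas_cst. Qed.

Lemma rlim_scal0 (a : I -> R) (c : Ω -> R) u y : rmeas c ->
  a i @[i --> F] --> (0 : R) ->
  (\forall i \near F, ae P (fun w => nrm (u i - y) w <= `|a i| * c w)) ->
  rlim F u y.
Proof.
move=> mc a0 h.
apply: (@rcvg0_mul R d Ω P I F FF (fun i => nrm (u i - y)) c
  (fun i _ => a i)) => //.
- by move=> i; exact: rnorm_meas.
- by move=> i; exact: measurable_cst.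
- apply: filterS h => i.
  apply: filterS2 (rnorm_ge0 M (u i - y)) => w p h.
  by rewrite ger0_norm// (le_trans h)// mulrC ler_wpM2r// ler_norm.
exact: rcvg0_const.
Qed.

End filter.

Section proper_filter.
Context (I : Type) (F : set_system I) {FF : ProperFilter F}.
Implicit Types (u v : I -> S).

Lemma rlim_unique u x y : rlim F u x -> rlim F u y -> x = y.
Proof.
move=> ux uy; apply/eqP; rewrite -subr_eq0; apply/eqP/(@rdist_eq0 _ _ _ _ _ M).
apply/eqP; rewrite eq_le rdist_ge0 andbT.
have h : rdist (u i - x) + rdist (u i - y) @[i --> F] --> (0 : R).
  by rewrite -[X in _ --> X]addr0; exact: cvgD.
apply: (cvgr_to_ge h); apply: nearW => i.
by rewrite (rdistC _ (u i) x); exact: rdist_tri.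
Qed.

(** The extra term [c * nrm (v i - y)] vanishes in probability although [c] may be unbounded. It
    accommodates bounds whose right-hand side is itself still converging, such as rounding errors of
    a step size. *)
Lemma nrm_lim_le u x (f : Ω -> R) (v : I -> S) y (c : Ω -> R) : rlim F u x ->
  rlim F v y -> rmeas f -> rmeas c ->
  (\forall i \near F,
    ae P (fun w => nrm (u i) w <= f w + c w * nrm (v i - y) w)) ->
  ae P (fun w => nrm x w <= f w).
Proof.
move=> ux vy mf mc h.
pose g i w : R := `|nrm (u i - x) w| + `|c w * nrm (v i - y) w|.
have m1 i : rmeas (fun w => c w * nrm (v i - y) w).
  by apply: measurable_funM => //; exact: rnorm_meas.
have mg i : rmeas (g i).
  apply: measurable_funD; apply: rmeas_norm => //; exact: rnorm_meas.
have : rcvg0 P F g.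
  apply: (@rcvg0_le_add R d Ω P I F _ g (fun i => nrm (u i - x))
    (fun i w => c w * nrm (v i - y) w)) => //.
  - by move=> i; exact: rnorm_meas.
  - by apply: nearW => i; apply: aeW => w; rewrite /g [leLHS]ger0_norm ?addr_ge0.
  apply: (@rcvg0_mul R d Ω P I F _ _ c (fun i => nrm (v i - y))) => //.
  - by move=> i; exact: rnorm_meas.
  - by apply: nearW => i; apply: aeW => w; rewrite normrM.
have mf' : rmeas (fun w => nrm x w - f w).
  by apply: measurable_funB => //; exact: rnorm_meas.
move=> /(fun H0 H1 => ae_le0_lim mf' mg H1 H0) H.
have : ae P (fun w => nrm x w - f w <= 0).
  apply: H; apply: filterS h => i h.
  apply: filterS3 h (nrm_le_dist M x (u i)) (nrm_distC M x (u i)) => w h1 h2 h3.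
  rewrite /g [leRHS]ger0_norm ?addr_ge0//.
  have := ler_norm (c w * nrm (v i - y) w); have := ler_norm (nrm (u i - x) w).
  by move: h1 h2 h3; set a := c w * _; lra.
by apply: filterS => w; rewrite subr_le0.
Qed.

Lemma nrm_lim_le_cst u x (f : Ω -> R) : rlim F u x -> rmeas f ->
  (\forall i \near F, ae P (fun w => nrm (u i) w <= f w)) ->
  ae P (fun w => nrm x w <= f w).
Proof.
move=> ux mf h; apply: (nrm_lim_le ux ux mf (measurable_cst (0 : R))).
by apply: filterS h => i; apply: filterS => w; rewrite mul0r addr0.
Qed.

Lemma rdist_lim_le u x e : rlim F u x -> (\forall i \near F, rdist (u i) <= e) ->
  rdist x <= e.
Proof.
move=> ux h.
have H : e + rdist (u i - x) @[i --> F] --> e.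
  by rewrite -[X in _ --> X]addr0; apply: cvgD => //; exact: cvg_cst.
apply: (cvgr_to_ge H); apply: filterS h => i h.
have := rdistD M (u i) (x - u i); rewrite addrC subrK.
by rewrite (rdistC _ x); lra.
Qed.

End proper_filter.

Lemma seq_cvgP u x : seq_cvg M u x <-> rlim \oo u x.
Proof.
rewrite rlim_nbhd; split=> h eps lam g.
  by have [N hN] := h _ _ g; exists N.
by have [N _ hN] := h _ _ g; exists N.
Qed.

Lemma lim_right0P f y : lim_right0 M f y <-> rlim (0 : R)^'+ f y.
Proof.
rewrite rlim_nbhd; split=> h eps lam g.
  have [e e0 he] := h _ _ g.
  near=> t; apply: he; apply/andP; split; near: t; first exact: nbhs_right_gt.
  exact: nbhs_right_lt.
have [e /= e0 he] := h _ _ g.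
exists e => // t /andP[t0 te]; apply: he => //=.
by rewrite sub0r normrN gtr0_norm.
Unshelve. all: by end_near.
Qed.

(** The points t / (n + 1) divide t exactly, so a quotient at t can be rewritten as an average of
    quotients at these steps. *)
Lemma rlim_right_div u x t : 0 < t -> rlim (0 : R)^'+ u x ->
  rlim \oo (fun n => u (t / n.+1%:R)) x.
Proof.
move=> t0 /rlimP h; apply/rlimP => e /h [a /= a0 ha].
have at0 : 0 < a / t by rewrite divr_gt0.
have /cvgrPdist_lt /(_ _ at0) := @cvg_harmonic R.
apply: filterS => n; rewrite /harmonic sub0r normrN => na.
apply: ha => /=; last by rewrite divr_gt0.
rewrite sub0r normrN normrM gtr0_norm//.
by rewrite mulrC -ltr_pdivlMr.
Qed.

Lemma RNcomplete_cauchy (u : nat -> S) : RNcomplete M ->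
  (forall e, 0 < e ->
    \forall n \near \oo, forall m, (n <= m)%N -> rdist (u m - u n) <= e) ->
  exists x, rlim \oo u x.
Proof.
move=> HC h; have [] := HC u; last by move=> x /seq_cvgP; exists x.
move=> eps lam g; have [p0 /andP[l0 l1]] := g.
pose q := lam * Num.min eps 1.
have q0 : 0 < q by rewrite mulr_gt0// lt_min p0 ltr01.
have [|N _ hN] := h (q / 4); first by rewrite divr_gt0.
exists N => m n Nm Nn; apply: rdist_lt_nbhd => //; rewrite -/q.
have := hN N (leqnn _) _ Nm; have := hN N (leqnn _) _ Nn.
have := rdist_tri M (u N) (u n) (u m); rewrite (rdistC _ (u N)).
by lra.
Qed.

Lemma RNcomplete_rlim (u : nat -> S) (e : nat -> R) : RNcomplete M ->
  e n @[n --> \oo] --> (0 : R) ->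
  (\forall n \near \oo, forall m, (n <= m)%N -> rdist (u m - u n) <= e n) ->
  exists x, rlim \oo u x.
Proof.
move=> HC /cvgr0Pnorm_lt e0 h; apply: RNcomplete_cauchy => // a /e0.
apply: filterS2 h => n h ha m nm; apply: le_trans (h m nm) _.
by apply: le_trans (ltW ha); exact: ler_norm.
Qed.

(** The ratio is below 1 only pointwise, so there is no geometric rate for the metric. The tail q^n
    c / (1 - q) still tends to 0 almost surely, hence in probability, and it dominates all later
    increments. *)
Lemma RNcomplete_ratio (u : nat -> S) (q c : Ω -> R) : RNcomplete M ->
  rmeas q -> rmeas c -> ae P (fun w => 0 <= q w < 1) ->
  ae P (fun w => 0 <= c w) ->
  (forall n, ae P (fun w => nrm (u n.+1 - u n) w <= q w ^+ n * c w)) ->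
  exists x, rlim \oo u x.
Proof.
move=> HC mq mc q01 c0 h.
pose b n w := q w ^+ n * (c w / (1 - q w)).
have mb n : rmeas (b n).
  apply: measurable_funM; first exact: measurable_funX.
  apply: measurable_funM => //; apply: rmeasV; exact: measurable_funB.
apply: (@RNcomplete_rlim u (fun n => rho P (b n))) => //.
  apply: rho_cvg0 => //; apply: filterS q01 => w /andP[q0 q1].
  rewrite -[X in _ --> X](mul0r (c w / (1 - q w))); apply: cvgM.
    by apply: cvg_expr; rewrite ger0_norm.
  exact: cvg_cst.
apply: nearW => n m nm; rewrite -(subnKC nm); elim: (m - n)%N => [|k _].
  by rewrite addn0 subrr rdist0; exact: rho_ge0.
apply: rho_le => //; first exact: rnorm_meas.
have : ae P (fun w => forall k, nrm (u (n + k)%N - u n) w <=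
    \sum_(i < k) q w ^+ (n + i) * c w).
  apply: ae_foralln; elim=> [|j IH].
    by apply: filterS (nrm0 M) => w; rewrite addn0 subrr big_ord0 => ->.
  apply: filterS3 IH (h (n + j)%N)
    (nrm_dist_tri M (u (n + j)%N) (u (n + j.+1)%N) (u n)) => w h1 h2 h3.
  rewrite big_ord_recr /= addrC (le_trans h3)// lerD//.
  by rewrite addnS.
move=> h'; have {c0 h'} := ae_and c0 h'.
apply: filterS3 q01 (rnorm_ge0 M (u (n + k.+1)%N - u n)).
move=> w /andP[q0 q1] p [c0 h'].
rewrite ger0_norm//; apply: le_trans (ler_norm _); apply: le_trans (h' _) _.
have -> : \sum_(i < k.+1) q w ^+ (n + i) * c w =
    q w ^+ n * ((1 - q w ^+ k.+1) / (1 - q w) * c w).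
  under eq_bigr do rewrite exprD -mulrA.
  rewrite -mulr_sumr -mulr_suml; congr (_ * (_ * _)).
  have q1' : 1 - q w != 0 by rewrite lt0r_neq0// subr_gt0.
  apply: (mulfI q1'); rewrite mulrCA divff// mulr1.
  by rewrite -opprB mulNr -subrX1 opprB.
rewrite /b ler_wpM2l ?exprn_ge0// mulrAC.
rewrite ler_wpM2r ?invr_ge0 ?subr_ge0 ?(ltW q1)//.
by rewrite -[leRHS]mul1r ler_wpM2r// gerBl exprn_ge0.
Qed.

End RN_limits.

(** * Essential infima and the L^0-valued operator norm *)

Section essential_infimum.
Context (R : realType) (d : measure_display) (Ω : measurableType d)
        (P : probability Ω R).
Implicit Types (f : Ω -> R) (Q : set (Ω -> R)).

Let lb0 (u : nat -> R) : has_lbound (range (fun n => `|u n|)).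
Proof. by exists 0 => _ [n _ <-]. Qed.

Let infs0_le (u : nat -> R) n : infs (fun n => `|u n|) 0 <= `|u n|.
Proof.
by apply: ge_inf; [exists 0 => _ [k _ <-]|exists n].
Qed.

Let infs0_glb (u : nat -> R) a : (forall n, a <= `|u n|) ->
  a <= infs (fun n => `|u n|) 0.
Proof.
move=> h; apply: lb_le_inf; first by exists `|u 0%N|; exists 0%N.
by move=> _ [n _ <-].
Qed.

(** An increasing injection of the half-line into [0, 1]: [rho] integrates it without truncation,
    and equal values force equal arguments. *)
Let h (t : R) := t / (1 + t).

Let h_ge0 t : 0 <= t -> 0 <= h t.
Proof. by move=> t0; rewrite divr_ge0// addr_ge0. Qed.

Let h_le1 t : 0 <= t -> h t <= 1.
Proof. by move=> t0; rewrite ler_pdivrMr; lra. Qed.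

Let h_le s t : 0 <= s -> s <= t -> h s <= h t.
Proof.
move=> s0 st; rewrite /h ler_pdivrMr; last by lra.
by rewrite mulrAC ler_pdivlMr; nra.
Qed.

Let h_inj s t : 0 <= s -> 0 <= t -> h s = h t -> s = t.
Proof.
move=> s0 t0 /eqP; rewrite /h eqr_div; try by apply: lt0r_neq0; lra.
by move/eqP; lra.
Qed.

Let hmeas f : rmeas f -> rmeas (fun w => h `|f w|).
Proof.
move=> mf; apply: measurable_funM; first exact: rmeas_norm.
by apply: rmeasV; apply: measurable_funD => //; exact: rmeas_norm.
Qed.

(* A minimising sequence for [E(f / (1 + f))] attains the infimum. *)
Lemma ess_inf_attained Q : (exists f, Q f) -> (forall f, Q f -> rmeas f) ->
  (forall f, Q f -> ae P (fun w => 0 <= f w)) ->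
  (forall u : nat -> Ω -> R, (forall n, Q (u n)) ->
    Q (fun w => infs (fun n => `|u n w|) 0)) ->
  exists2 z, Q z & forall f, Q f -> ae P (fun w => z w <= f w).
Proof.
move=> [f0 Qf0] Qm Q0 Qinf.
pose phi f := rho P (fun w => h `|f w|).
pose A := [set phi f | f in Q].
have lA : has_inf A.
  by split; [exists (phi f0); exists f0|exists 0 => _ [f _ <-]; exact: rho_ge0].
have /choice[u hu] : forall n : nat, exists f, Q f /\ phi f < inf A + n.+1%:R^-1.
  move=> n; have n0 : 0 < n.+1%:R^-1 :> R by rewrite invr_gt0.
  by have [_ [f Qf <-] hf] := inf_adherent n0 lA; exists f.
pose z w := infs (fun n => `|u n w|) 0.
have Qz : Q z by apply: Qinf => n; case: (hu n).
have z0 w : 0 <= z w by exact: infs0_glb.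
have phiz : phi z <= inf A.
  have H : inf A + n.+1%:R^-1 @[n --> \oo] --> inf A.
    rewrite -[X in _ --> X]addr0; apply: cvgD; first exact: cvg_cst.
    exact: cvg_harmonic.
  apply: (cvgr_to_ge H); apply: nearW => n.
  apply: le_trans (ltW (proj2 (hu n))); apply: rho_le.
  - exact/hmeas/Qm.
  - by apply/hmeas/Qm; case: (hu n).
  apply: aeW => w; rewrite (ger0_norm (h_ge0 (normr_ge0 (z w)))).
  rewrite (ger0_norm (h_ge0 (normr_ge0 (u n w)))).
  by rewrite h_le// (ger0_norm (z0 w)); exact: infs0_le.
exists z => // f Qf.
(* The sequence z, f, f, ... puts the minimum of z and f into [Q]. Since [z] already minimises
   [phi], that minimum must agree with [z] almost surely. *)
pose v (n : nat) := if n is 0 then z else f.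
pose z' w := infs (fun n => `|v n w|) 0.
have Qz' : Q z' by apply: Qinf => -[|n].
have z'0 w : 0 <= z' w by exact: infs0_glb.
have z'z w : z' w <= z w.
  by have := infs0_le (fun n => v n w) 0; rewrite /= ger0_norm.
have mz := hmeas (Qm _ Qz); have mz' := hmeas (Qm _ Qz').
pose g w := h `|z w| - h `|z' w|.
have mg : rmeas g by exact: measurable_funB.
have g0 w : 0 <= g w by rewrite subr_ge0 h_le// !ger0_norm.
have : rho P g = 0.
  apply/eqP; rewrite eq_le rho_ge0 andbT.
  have : phi z = phi z' + rho P g.
    rewrite -rho_add//; last 2 first.
    - by move=> w; exact: h_ge0.
    - by move=> w; rewrite addrC subrK h_le1.
    by congr rho; apply/funext => w; rewrite addrC subrK.
  have : inf A <= phi z' by apply: ge_inf; [case: lA|exists z'].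
  by lra.
move/(rho_eq0 mg); apply: filterS2 (Q0 _ Qf) => w f0w /eqP.
rewrite subr_eq0 !ger0_norm// => /eqP/h_inj -> //.
by have := infs0_le (fun n => v n w) 1; rewrite /= (ger0_norm f0w).
Qed.

Lemma measurable_infs0 (u : nat -> Ω -> R) : (forall n, rmeas (u n)) ->
  rmeas (fun w => infs (fun n => `|u n w|) 0).
Proof.
move=> mu; apply: (@measurable_fun_infs _ _ _ _ (fun n w => `|u n w|)).
  by move=> w _; exact: lb0.
by move=> n; exact: rmeas_norm.
Qed.

Context (S : zmodType) (M : RNModule P S).
Local Notation nrm := (rnorm M).

Lemma opnorm_le_bound (T : S -> S) (eta : Ω -> R) x : opnorm_le M T eta ->
  ae P (fun w => nrm (T x) w <= eta w * nrm x w).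
Proof.
move=> [zeta [[mz [lbz glbz]] ze]].
have [[xi bxi]|none] := pselect (exists xi, opbound M T xi); last first.
  (* Over an empty family of bounds every measurable function is a lower bound, so even [zeta + 1]
     would lie below the infimum [zeta], which is absurd. *)
  have mz1 : rmeas (fun w => zeta w + 1) by exact: measurable_funD.
  have H : ae P (fun w => zeta w + 1 <= zeta w).
    by apply: glbz => // xi bxi; exfalso; apply: none; exists xi.
  by apply: filterS H => w; lra.
(* This quotient lies below every operator bound, hence below [zeta]; where the norm of x vanishes,
   division by zero gives it the harmless value 0. *)
pose z w := nrm (T x) w / nrm x w.
have mzz : rmeas z.
  apply: measurable_funM; first exact: rnorm_meas.
  exact/rmeasV/rnorm_meas.
have H : ae P (fun w => z w <= zeta w).
  apply: glbz => // {bxi}xi [mxi [xi0 /(_ x) bxi]].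
  apply: filterS3 xi0 bxi (rnorm_ge0 M x) => w xi0 b.
  rewrite le_eqVlt /z => /predU1P[<-|x0]; first by rewrite invr0 mulr0.
  by rewrite ler_pdivrMr.
case: bxi => _ [_ /(_ x) bxi].
have := ae_and H ze.
apply: filterS3 (rnorm_ge0 M x) bxi => w + b [].
rewrite le_eqVlt /z => /predU1P[x0|x0] h1 h2.
  by move: b; rewrite -x0 !mulr0.
by rewrite -ler_pdivrMr// (le_trans h1).
Qed.

(** [opnorm_le] includes the existence of the infimum. Countable infima of operator bounds are
    operator bounds, so the infimum is attained within the family. *)
Lemma opnorm_le_intro (T : S -> S) (eta : Ω -> R) : opbound M T eta ->
  opnorm_le M T eta.
Proof.
move=> beta; have := @ess_inf_attained [set xi | opbound M T xi].
case=> /=.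
- by exists eta.
- by move=> f [].
- by move=> f [_ []].
- move=> u hu; split; first by apply: measurable_infs0 => n; case: (hu n).
  split; first by apply: aeW => w; exact: infs0_glb.
  move=> x; have : ae P (fun w => forall n, nrm (T x) w <= u n w * nrm x w).
    by apply: ae_foralln => n; exact: (proj2 (proj2 (hu n)) x).
  apply: filterS2 (rnorm_ge0 M x) => w + hn.
  rewrite le_eqVlt => /predU1P[x0|x0].
    by have := hn 0%N; rewrite -x0 !mulr0.
  rewrite -ler_pdivrMr//; apply: infs0_glb => n.
  by rewrite ler_pdivrMr// (le_trans (hn n))// ler_wpM2r ?(ltW x0)// ler_norm.
move=> z bz hz; exists z; split; last exact: hz.
split; first by case: bz.
by split => // z' mz'; exact.
Qed.

End essential_infimum.

(** * Continuous homomorphisms, closed operators and contractions *)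

Section RN_operators.
Context (R : realType) (d : measure_display) (Ω : measurableType d)
        (P : probability Ω R) (S : zmodType) (M : RNModule P S).
Local Notation nrm := (rnorm M).
Local Notation "xi *s x" := (smul M xi x) (at level 40).
Local Notation "t *r x" := (rscale M t x) (at level 40).
Local Notation rdist := (rdist M).
Local Notation rlim := (rlim M).
Implicit Types (x y z : S) (xi eta : Ω -> R[i]) (t : R).

Lemma continuousEL_intro (T : S -> S) (c : Ω -> R) : rmeas c ->
  (forall x y, ae P (fun w => nrm (T x - T y) w <= c w * nrm (x - y) w)) ->
  continuousEL M T.
Proof.
move=> mc hT x eps lam g; have [e0 /andP[l0 l1]] := g.
pose e := lam * Num.min eps 1.
have e1 : 0 < e by rewrite mulr_gt0// lt_min e0 ltr01.
have [n _ /(_ n (leqnn _)) /= cn] :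
    \forall n \near \oo, rho P (fun w => c w / n.+1%:R) < e / 2.
  have /cvgr0Pnorm_lt/(_ (e / 2)) := rho_div_cvg0 P mc.
  rewrite divr_gt0// => /(_ isT); apply: filterS => n.
  by rewrite ger0_norm ?rho_ge0.
(* With the factor 2 of [nbhd_rdist_le], the 8 leaves (n + 1) 2 a <= e / 4; the cap 1/2 keeps [a]
   admissible as a probability level. *)
pose a := Num.min (e / (8 * n.+1%:R)) (1 / 2).
have a0 : 0 < a by rewrite lt_min !divr_gt0// mulr_gt0.
have ga : goodEL a a.
  split=> //; rewrite a0 /=; apply: (@le_lt_trans _ _ (1 / 2)); last by lra.
  by rewrite ge_min lexx orbT.
exists a, a; split => // y /(nbhd_rdist_le ga) hy.
apply: rdist_lt_nbhd => //; rewrite -/e.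
have n1 : 1 <= n.+1%:R :> R by rewrite ler1n.
apply: (@le_lt_trans _ _ (n.+1%:R * rdist (y - x) + rho P (fun w => c w / n.+1%:R))).
  apply: rho_mul => //; try exact: rnorm_meas.
  apply: filterS3 (hT y x) (rnorm_ge0 M (T y - T x)) (rnorm_ge0 M (y - x)).
  move=> w h1 h2 h3; rewrite ger0_norm// (ger0_norm h3) (le_trans h1)//.
  by rewrite ler_wpM2r// ler_norm.
have : n.+1%:R * rdist (y - x) <= n.+1%:R * (2 * (e / (8 * n.+1%:R))).
  rewrite ler_wpM2l// (le_trans hy)// ler_wpM2l//.
  by rewrite /a ge_min lexx.
rewrite (_ : n.+1%:R * (2 * _) = e / 4); last first.
  by move: (n.+1%:R : R) n1 => K n1; field; apply: lt0r_neq0; lra.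
by lra.
Qed.

Lemma modhomB (D : set S) A : submodule M D -> modhom_on M D A ->
  forall x y, D x -> D y -> A (x - y) = A x - A y.
Proof.
move=> [D0 [DD DZ]] [AD AZ] x y Dx Dy.
have Ny : - y = (-1) *r y by rewrite rscaleNl rscale1.
have m : cmeas (cst (-1)%:C%C : Ω -> R[i]) by exact: cmeas_cst.
rewrite Ny AD//; last exact: DZ.
by rewrite [A ((-1) *r y)]AZ// -/(rscale M (-1) (A y)) rscaleNl rscale1.
Qed.

Lemma submoduleT : submodule M setT. Proof. by []. Qed.

Lemma bounded_op_intro (T : S -> S) (c : Ω -> R) : modhom_on M setT T ->
  rmeas c -> (forall x, ae P (fun w => nrm (T x) w <= c w * nrm x w)) ->
  bounded_op M T.
Proof.
move=> hT mc h; split => //; apply: (continuousEL_intro mc) => x y.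
by rewrite -(modhomB submoduleT hT).
Qed.

(** Solutions inherit the Cauchy property from convergent right-hand sides through a random a priori
    bound, again by cutting [c] at a level. *)
Lemma RNcomplete_transfer (u v : nat -> S) y (c : Ω -> R) : RNcomplete M ->
  rmeas c -> rlim \oo v y ->
  (forall m n, ae P (fun w => nrm (u m - u n) w <= c w * nrm (v m - v n) w)) ->
  exists x, rlim \oo u x.
Proof.
move=> HC mc vy h; apply: RNcomplete_cauchy => // e e0.
have [k _ /(_ k (leqnn _)) /= ck] :
    \forall k \near \oo, rho P (fun w => c w / k.+1%:R) < e / 2.
  have /cvgr0Pnorm_lt/(_ (e / 2)) := rho_div_cvg0 P mc.
  rewrite divr_gt0// => /(_ isT); apply: filterS => n.
  by rewrite ger0_norm ?rho_ge0.
have k1 : 1 <= k.+1%:R :> R by rewrite ler1n.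
have a0 : 0 < e / 4 / k.+1%:R by rewrite !divr_gt0.
have /rlimP/(_ _ a0)[N _ hN] := vy.
exists N => // n /= Nn m nm.
have hn := hN _ Nn; have hm := hN _ (leq_trans Nn nm); rewrite /= in hn hm.
have hmn : rdist (v m - v n) <= e / 2 / k.+1%:R.
  have := rdist_tri M y (v m) (v n); rewrite (rdistC _ y).
  have -> : e / 2 / k.+1%:R = e / 4 / k.+1%:R + e / 4 / k.+1%:R.
    by rewrite -mulrDl; congr (_ / _); lra.
  by move: (e / 4 / k.+1%:R) hn hm => a; lra.
apply: (@le_trans _ _ (k.+1%:R * rdist (v m - v n) + rho P (fun w => c w / k.+1%:R))).
  apply: rho_mul => //; try exact: rnorm_meas.
  apply: filterS3 (h m n) (rnorm_ge0 M (u m - u n)) (rnorm_ge0 M (v m - v n)).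
  move=> w h1 h2 h3; rewrite ger0_norm// (ger0_norm h3) (le_trans h1)//.
  by rewrite ler_wpM2r// ler_norm.
rewrite ler_pdivlMr// in hmn; move: hmn; rewrite mulrC => hmn.
by lra.
Qed.

Lemma closed_op_intro (D : set S) A :
  (forall (u : nat -> S) x y, (forall n, D (u n)) -> rlim \oo u x ->
    rlim \oo (A \o u) y -> D x /\ A x = y) ->
  closed_op M D A.
Proof.
move=> h x y nxy; apply: contrapT => H; apply: nxy.
(* Starting at 1/2 rather than 1 keeps the probability level strictly below 1, as [goodEL]
   demands. *)
have e0 n : 0 < n.+2%:R^-1 :> R by rewrite invr_gt0.
have g n : goodEL (n.+2%:R^-1 : R) n.+2%:R^-1.
  split=> //; rewrite e0/= invf_lt1 ?ltr0n// -[X in X < _]/(1%:R).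
  by rewrite ltr_nat.
have /choice[u hu] : forall n : nat, exists z, D z /\
    nbhdEL M x n.+2%:R^-1 n.+2%:R^-1 z /\ nbhdEL M y n.+2%:R^-1 n.+2%:R^-1 (A z).
  move=> n; apply: contrapT => H'; apply: H.
  exists n.+2%:R^-1, n.+2%:R^-1; split => // z Dz [h1 h2].
  by apply: H'; exists z.
have c0 : 2 * n.+2%:R^-1 @[n --> \oo] --> (0 : R).
  rewrite -[X in _ --> X](mulr0 2); apply: cvgM; first exact: cvg_cst.
  by have := @cvg_harmonic R; rewrite -cvg_shiftS.
apply: (h u); first by move=> n; case: (hu n).
  apply: (rlim_squeeze _ c0); apply: nearW => n.
  by case: (hu n) => _ [h1 _]; exact: nbhd_rdist_le (g n) h1.
apply: (rlim_squeeze _ c0); apply: nearW => n.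
by case: (hu n) => _ [_ h1]; exact: nbhd_rdist_le (g n) h1.
Qed.

Lemma RNdenseP (D : set S) : RNdense M D <->
  forall x e, 0 < e -> exists2 z, D z & rdist (z - x) < e.
Proof.
split=> [h x e e0|h x eps lam g].
  pose a := Num.min (e / 4) (1 / 2).
  have a0 : 0 < a by rewrite lt_min !divr_gt0.
  have a2 : a <= e / 4 by rewrite ge_min lexx.
  have ga : goodEL a a.
    split=> //; rewrite a0 /=; apply: (@le_lt_trans _ _ (1 / 2)); last by lra.
    by rewrite ge_min lexx orbT.
  have [z [Dz /(nbhd_rdist_le ga) hz]] := h x _ _ ga.
  by exists z => //; lra.
have [e0 /andP[l0 l1]] := g.
have e1 : 0 < lam * Num.min eps 1 by rewrite mulr_gt0// lt_min e0 ltr01.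
by have [z Dz hz] := h x _ e1; exists z; split => //; exact: rdist_lt_nbhd.
Qed.

Lemma RNdense_seq (D : set S) x : RNdense M D ->
  exists2 u : nat -> S, (forall n, D (u n)) & rlim \oo u x.
Proof.
move=> /RNdenseP h.
have /choice[u hu] : forall n : nat, exists z, D z /\ rdist (z - x) < n.+1%:R^-1.
  move=> n; have n0 : 0 < n.+1%:R^-1 :> R by rewrite invr_gt0.
  by have [z Dz hz] := h x _ n0; exists z.
exists u; first by move=> n; case: (hu n).
apply: (rlim_squeeze _ (@cvg_harmonic R)); apply: nearW => n.
by case: (hu n) => _ /ltW.
Qed.

(** Working form of membership in B(S) with norm at most 1, stated without the lattice infimum;
    [contr_intro], [contr_bounded_op] and [contr_opnorm_le] translate between the two. *)
Definition contraction (T : S -> S) :=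
  modhom_on M setT T /\ forall x, ae P (fun w => nrm (T x) w <= nrm x w).

Section contraction.
Variable T : S -> S.
Hypothesis cT : contraction T.

Lemma contrD x y : T (x + y) = T x + T y.
Proof. by case: cT => -[h _] _; exact: h. Qed.

Lemma contrB x y : T (x - y) = T x - T y.
Proof. by case: cT => h _; exact: (modhomB submoduleT h). Qed.

Lemma contrZ xi x : cmeas xi -> T (xi *s x) = xi *s T x.
Proof. by case: cT => -[_ h] _ m; exact: h. Qed.

Lemma contr_rscale t x : T (t *r x) = t *r T x.
Proof. exact/contrZ/cmeas_cst. Qed.

Lemma contr0 : T 0 = 0.
Proof. by apply: (@addrI _ (T 0)); rewrite -contrD !addr0. Qed.

Lemma contr_sum (n : nat) (u : nat -> S) :
  T (\sum_(k < n) u k) = \sum_(k < n) T (u k).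
Proof.
elim: n => [|n IH]; first by rewrite !big_ord0 contr0.
by rewrite !big_ord_recr /= contrD IH.
Qed.

Lemma contr_le x : ae P (fun w => nrm (T x) w <= nrm x w).
Proof. by case: cT. Qed.

Lemma rdist_contr x : rdist (T x) <= rdist x.
Proof. exact/rdist_le/contr_le. Qed.

Lemma rlim_contr (I : Type) (F : set_system I) {FF : Filter F} (u : I -> S) x :
  rlim F u x -> rlim F (fun i => T (u i)) (T x).
Proof. by apply: rlim_le; apply: nearW => i; rewrite -contrB; exact: contr_le. Qed.

End contraction.

Lemma contr_id : contraction id.
Proof. by split => // x; apply: aeW. Qed.

Lemma contr_comp T T' : contraction T -> contraction T' ->
  contraction (fun x => T (T' x)).
Proof.
move=> cT cT'; split; first split.
- by move=> x y _ _; rewrite (contrD cT') (contrD cT).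
- by move=> xi x m _; rewrite (contrZ cT')// (contrZ cT).
move=> x; apply: filterS2 (contr_le cT (T' x)) (contr_le cT' x) => w h.
exact: le_trans.
Qed.

Lemma contr_iter T n : contraction T -> contraction (iter n T).
Proof.
move=> cT; elim: n => [|n IH]; first exact: contr_id.
exact: (contr_comp cT IH).
Qed.

Lemma contr_dense_cvg (U : nat -> S -> S) (D : set S) : RNcomplete M ->
  RNdense M D -> (forall n, contraction (U n)) ->
  (forall x, D x -> exists y, rlim \oo (fun n => U n x) y) ->
  forall x, exists y, rlim \oo (fun n => U n x) y.
Proof.
move=> HC /RNdenseP dD cU hD x.
have [] := HC (fun n => U n x); last by move=> y /seq_cvgP; exists y.
move=> eps lam g; have [p0 /andP[l0 l1]] := g.
have q0 : 0 < lam * Num.min eps 1 by rewrite mulr_gt0// lt_min p0 ltr01.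
have q1 : 0 < lam * Num.min eps 1 / 4 by rewrite divr_gt0.
have [z Dz hz] := dD x _ q1; have [y /rlimP/(_ _ q1)[N _ hN]] := hD z Dz.
exists N => m n Nm Nn; apply: rdist_lt_nbhd => //.
have h1 := hN _ Nm; have h2 := hN _ Nn; rewrite /= in h1 h2.
have h3 k : rdist (U k x - U k z) <= rdist (z - x).
  by rewrite -(contrB (cU k)) (rdistC _ z); exact: rdist_contr.
have := rdist_tri M (U n z) (U n x) (U m x).
have := rdist_tri M y (U n z) (U m x).
have := rdist_tri M (U m z) y (U m x).
have := h3 n; have := h3 m.
rewrite (rdistC _ y (U m z)) (rdistC _ (U m z) (U m x)).
by move: (lam * Num.min eps 1) h1 h2 hz => K; lra.
Qed.

Lemma contr_dense_eq T T' (D : set S) : RNdense M D -> contraction T ->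
  contraction T' -> (forall x, D x -> T x = T' x) -> T =1 T'.
Proof.
move=> dD cT cT' h x; have [u Du ux] := RNdense_seq x dD.
apply: (rlim_unique (rlim_contr cT ux)).
apply: rlim_eq (rlim_contr cT' ux).
by apply: nearW => n; rewrite h.
Qed.

Lemma contr_lim (U : nat -> S -> S) T : (forall n, contraction (U n)) ->
  (forall x, rlim \oo (fun n => U n x) (T x)) -> contraction T.
Proof.
move=> cU hU; split; first split.
- move=> x y _ _; apply: (rlim_unique (hU _)).
  apply: rlim_eq (rlimD (hU x) (hU y)).
  by apply: nearW => n; rewrite contrD.
- move=> xi x m _; apply: (rlim_unique (hU _)).
  apply: rlim_eq (rlimZ m (hU x)).
  by apply: nearW => n; rewrite contrZ.
move=> x; apply: (nrm_lim_le_cst (hU x)); first exact: rnorm_meas.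
by apply: nearW => n; exact: contr_le.
Qed.

Lemma contr_opnorm_le T : contraction T -> opnorm_le M T (fun=> 1).
Proof.
move=> cT; apply: opnorm_le_intro; split; first exact: measurable_cst.
split; first exact: aeW.
by move=> x; apply: filterS (contr_le cT x) => w; rewrite mul1r.
Qed.

Lemma contr_bounded_op T : contraction T -> bounded_op M T.
Proof.
move=> cT; apply: (@bounded_op_intro _ (fun=> 1)); first by case: cT.
  exact: measurable_cst.
by move=> x; apply: filterS (contr_le cT x) => w; rewrite mul1r.
Qed.

Lemma contr_intro T : bounded_op M T -> opnorm_le M T (fun=> 1) -> contraction T.
Proof.
move=> [hT _] h; split => // x.
by apply: filterS (opnorm_le_bound x h) => w; rewrite mul1r.
Qed.

(** Banach iteration from 0. The increments are bounded by q^n times the first one almost surely,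
    which is all that [RNcomplete_ratio] asks. *)
Lemma random_fixed_point (G : S -> S) (q : Ω -> R) : RNcomplete M ->
  rmeas q -> ae P (fun w => 0 <= q w < 1) ->
  (forall x y, ae P (fun w => nrm (G x - G y) w <= q w * nrm (x - y) w)) ->
  exists x, G x = x.
Proof.
move=> HC mq q01 hG; pose u n := iter n G 0.
have [|||n|x ux] := @RNcomplete_ratio _ _ _ _ _ M u q (nrm (u 1%N - u 0%N)) HC mq.
- exact: rnorm_meas.
- by [].
- exact: rnorm_ge0.
- elim: n => [|n IH]; first by apply: aeW => w; rewrite expr0 mul1r.
  apply: filterS3 q01 (hG (u n.+1) (u n)) IH => w /andP[q0 _] h1 h2.
  by rewrite (le_trans h1)// exprS -mulrA ler_wpM2l.
exists x; have h : rlim \oo (fun n => G (u n)) (G x).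
  by apply: (rlim_bound mq) ux; apply: nearW => n; exact: hG.
apply: (rlim_unique h).
have : rdist (u n - x) @[n --> \oo] --> (0 : R) by exact: ux.
by rewrite -cvg_shiftS.
Qed.

End RN_operators.

(** * Contraction semigroups: difference quotients and orbit averages *)

Section contraction_semigroup.
Context (R : realType) (d : measure_display) (Ω : measurableType d)
        (P : probability Ω R) (S : zmodType) (M : RNModule P S).
Local Notation nrm := (rnorm M).
Local Notation "xi *s x" := (smul M xi x) (at level 40).
Local Notation "t *r x" := (rscale M t x) (at level 40).
Local Notation rdist := (rdist M).
Local Notation rlim := (rlim M).
Implicit Types (x y z : S) (xi eta : Ω -> R[i]) (s t h : R).

(** The scalar is 1 / (2 (1 + |y|)), whose inverse again lies in L^0, so limits taken after scaling
    can be scaled back. The bound is 1/2 because the quantity to keep below 1 is |T(s) y - y| <= 2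
    |y|. *)
Lemma normalizer y : exists c c' : Ω -> R[i],
  [/\ cmeas c, cmeas c', (forall x, c' *s (c *s x) = x) &
      ae P (fun w => nrm (c *s y) w <= 1 / 2)].
Proof.
pose f w : R := 2 * (1 + `|nrm y w|).
have f0 w : 0 < f w by rewrite mulr_gt0// ltr_pwDl.
have mf : rmeas f.
  apply: measurable_funM => //; apply: measurable_funD => //.
  exact/rmeas_norm/rnorm_meas.
have mc := cmeas_rC (rmeasV mf); have mc' := cmeas_rC mf.
exists (rC (fun w => (f w)^-1)), (rC f); split => //.
  move=> x; rewrite smulA// -[RHS](smul1 M); congr smul; apply/funext => w.
  by rewrite /rC -rmorphM /= divff// lt0r_neq0.
apply: filterS2 (rnormZ M y mc) (rnorm_ge0 M y) => w -> y0.
rewrite /rC cabsR gtr0_norm ?invr_gt0// mulrC ler_pdivrMr// /f ger0_norm//.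
by lra.
Qed.

Variable T : R -> S -> S.
Hypothesis cT : forall t, 0 <= t -> contraction M (T t).
Hypothesis T0 : forall x, T 0 x = x.
Hypothesis TD : forall s t x, 0 <= s -> 0 <= t -> T s (T t x) = T (s + t) x.
Hypothesis Tc : forall x, rlim (0 : R)^'+ (fun t => T t x) x.

Definition dquot t x := t^-1 *r (T t x - x).

Lemma TC s t x : 0 <= s -> 0 <= t -> T s (T t x) = T t (T s x).
Proof. by move=> s0 t0; rewrite !TD// addrC. Qed.

Lemma dquotB t x y : 0 <= t -> dquot t (x - y) = dquot t x - dquot t y.
Proof.
move=> t0; rewrite /dquot (contrB (cT t0)) -rscaleBr; congr rscale.
by zmod.
Qed.

Lemma dquotZ t xi x : 0 <= t -> cmeas xi -> dquot t (xi *s x) = xi *s dquot t x.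
Proof.
by move=> t0 m; rewrite /dquot (contrZ (cT t0))// -smulBr// smul_rscale.
Qed.

Lemma dquotC s t x : 0 <= s -> 0 <= t ->
  dquot s (dquot t x) = dquot t (dquot s x).
Proof.
move=> s0 t0; rewrite {1}/dquot [in LHS]/dquot (contr_rscale (cT s0)) -rscaleBr.
rewrite {2}/dquot [in RHS]/dquot (contr_rscale (cT t0)) -rscaleBr.
rewrite !rscaleA mulrC; congr rscale.
rewrite !(contrB (cT s0), contrB (cT t0)) TC//.
by zmod.
Qed.

Lemma rlim_dquot t (u : nat -> S) x : 0 <= t -> rlim \oo u x ->
  rlim \oo (fun n => dquot t (u n)) (dquot t x).
Proof.
move=> t0 ux; apply: rlim_rscale; apply: rlimB => //.
exact: (rlim_contr (cT t0)).
Qed.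

(** Clearing the denominator t isolates T(t) x. Both the dissipative estimate and the fixed point
    form of the resolvent equation are read off this identity. *)
Lemma rscale_resolvent_dquot t xi x : 0 < t -> cmeas xi ->
  t *r (xi *s x - dquot t x) = (fun w => 1 + t%:C%C * xi w) *s x - T t x.
Proof.
move=> t0 m.
have mt : cmeas (cst t%:C%C : Ω -> R[i]) by exact: cmeas_cst.
have mtx : cmeas (fun w => t%:C%C * xi w) by exact: (cmeasM mt).
rewrite rscaleBr /dquot rscaleA divff ?lt0r_neq0// rscale1.
have -> : (fun w => 1 + t%:C%C * xi w) *s x =
    x + (fun w => t%:C%C * xi w) *s x.
  by rewrite -[X in X + _](smul1 M) -smulDl//; exact: (@cmeas_cst _ _ _ 1).
have -> : t *r (xi *s x) = (fun w => t%:C%C * xi w) *s x.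
  by rewrite /rscale smulA.
by zmod.
Qed.

(** It follows from |1 + t xi| >= 1 + t Re xi and |T(t) x| <= |x| after division by t. *)
Lemma dquot_dissipative t xi x : 0 < t -> cmeas xi ->
  ae P (fun w => complex.Re (xi w) * nrm x w <= nrm (xi *s x - dquot t x) w).
Proof.
move=> t0 m; pose eta := fun w => 1 + t%:C%C * xi w.
have meta : cmeas eta.
  apply: cmeasD; first exact: (@cmeas_cst _ _ _ 1).
  by apply: cmeasM => //; exact: (@cmeas_cst _ _ _ t%:C%C).
have E := rscale_resolvent_dquot x t0 m.
have h1 := nrm_rscale M t (xi *s x - dquot t x); rewrite E in h1.
have := ae_and h1 (rnormZ M x meta).
apply: filterS3 (ae_and (contr_le (cT (ltW t0)) x) (rnorm_ge0 M x))
  (nrm_le_dist M (eta *s x) (T t x)) => w [h2 x0] h3 [h4 h5].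
have h6 : 1 + t * complex.Re (xi w) <= cabs (eta w).
  apply: le_trans (Re_le_cabs _); rewrite /eta ReD /=.
  by case: (xi w) => a b /=; rewrite mul0r subr0.
rewrite -(ler_pM2l t0) mulrA; move: h4; rewrite (gtr0_norm t0) => <-.
have := ler_wpM2r x0 h6; rewrite -h5 mulrDl mul1r.
by move: h2 h3; lra.
Qed.

Lemma small_orbit x e : 0 < e ->
  exists2 δ, 0 < δ & forall s, 0 <= s < δ -> rdist (T s x - x) <= e.
Proof.
move=> e0; have /rlimP/(_ _ e0)[δ /= δ0 hδ] := Tc x.
exists δ => // s /andP[]; rewrite le_eqVlt => /predU1P[<- _|s0 sδ].
  by rewrite T0 subrr rdist0 ltW.
by apply/ltW/hδ => //=; rewrite sub0r normrN gtr0_norm.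
Qed.

(** Up to the factor h this is the left Riemann sum of the orbit over [0, n h]; [orbit_avg] is the
    matching mean value. *)
Definition orbit_sum n h x := \sum_(k < n) T (k%:R * h) x.
Definition orbit_avg n h x := n%:R^-1 *r orbit_sum n h x.

Let kh0 k h : 0 <= h -> 0 <= k%:R * h.
Proof. by move=> h0; rewrite mulr_ge0. Qed.

Lemma orbit_sum_add n m h x : 0 <= h ->
  orbit_sum (n + m) h x = orbit_sum n h x + T (n%:R * h) (orbit_sum m h x).
Proof.
move=> h0; elim: m => [|m IH].
  by rewrite addn0 /orbit_sum big_ord0 (contr0 (cT (kh0 n h0))) addr0.
rewrite /orbit_sum addnS !big_ord_recr /= (contrD (cT (kh0 n h0))) addrA.
congr (_ + _); first exact: IH.
by rewrite TD ?kh0// natrD mulrDl.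
Qed.

Lemma orbit_sum_contr t n h x : 0 <= t -> 0 <= h ->
  T t (orbit_sum n h x) = orbit_sum n h (T t x).
Proof.
move=> t0 h0; rewrite /orbit_sum.
rewrite (contr_sum (cT t0) n (fun k => T (k%:R * h) x)).
by apply: eq_bigr => k _; rewrite TC ?kh0.
Qed.

Lemma orbit_avg_commute t n h x : 0 <= t -> 0 <= h ->
  T t (orbit_avg n h x) = orbit_avg n h (T t x).
Proof.
by move=> t0 h0; rewrite /orbit_avg (contr_rscale (cT t0)) orbit_sum_contr.
Qed.

Lemma orbit_avg_contr n h : 0 <= h -> (0 < n)%N -> contraction M (orbit_avg n h).
Proof.
move=> h0 n0; split; first split.
- move=> x y _ _; rewrite /orbit_avg -rscaleDr -big_split; congr rscale.
  by apply: eq_bigr => k _; rewrite (contrD (cT (kh0 k h0))).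
- move=> xi x m _; rewrite /orbit_avg smul_rscale//; congr rscale.
  rewrite /orbit_sum; elim: {n0}n => [|n IH]; first by rewrite !big_ord0 smul0r.
  by rewrite !big_ord_recr /= IH smulDr// (contrZ (cT (kh0 n h0))).
move=> x; have hk : ae P (fun w => forall k : nat, nrm (T (k%:R * h) x) w <= nrm x w).
  by apply: ae_foralln => k; exact/contr_le/cT/kh0.
apply: filterS3 hk (nrm_rscale M n%:R^-1 (orbit_sum n h x))
  (nrm_sum M n (fun k => T (k%:R * h) x)) => w h1 -> h2.
rewrite ger0_norm ?invr_ge0// ler_pdivrMl ?ltr0n// (le_trans h2)//.
rewrite mulr_natl -[X in _ *+ X]card_ord -sumr_const.
by apply: ler_sum => k _.
Qed.

Lemma orbit_avg_close n h x e : 0 <= h -> (0 < n)%N ->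
  ae P (fun w => nrm x w <= 1 / 2) ->
  (forall k, (k < n)%N -> rdist (T (k%:R * h) x - x) <= e) ->
  rdist (orbit_avg n h x - x) <= e.
Proof.
move=> h0 n0 x1 he.
have n0R : n%:R != 0 :> R by rewrite pnatr_eq0 -lt0n.
apply: (@rho_avg _ _ _ P n (fun k => nrm (T (k%:R * h) x - x))) => //.
- exact: rnorm_meas.
- by move=> k; exact: rnorm_meas.
- apply: ae_foralln => k.
  apply: filterS3 (ae_and (nrmB M (T (k%:R * h) x) x)
      (rnorm_ge0 M (T (k%:R * h) x - x)))
    (contr_le (cT (kh0 k h0)) x) x1 => w [h1 h2] h3 h4.
  by rewrite ger0_norm//; lra.
have E : orbit_avg n h x - x = n%:R^-1 *r \sum_(k < n) (T (k%:R * h) x - x).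
  by rewrite sumrB rscaleBr (sumr_rscale M) rscaleA mulVf// rscale1.
rewrite E.
have := nrm_rscale M n%:R^-1 (\sum_(k < n) (T (k%:R * h) x - x)).
apply: filterS3 (nrm_sum M n (fun k => T (k%:R * h) x - x))
  (rnorm_ge0 M (n%:R^-1 *r \sum_(k < n) (T (k%:R * h) x - x))) => w h1 h2 h3.
rewrite ger0_norm// h3 ger0_norm ?invr_ge0// ler_wpM2l ?invr_ge0//.
by rewrite (le_trans h1)//; apply: ler_sum => k _; exact: ler_norm.
Qed.

(** Telescoping of T(nh) x - x along the nodes k h: the discrete form of T(t) x - x being the
    integral of T(s) A x. *)
Lemma dquot_avg n h x : 0 < h -> (0 < n)%N ->
  dquot (n%:R * h) x = orbit_avg n h (dquot h x).
Proof.
move=> h0 n0; have h0' := ltW h0.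
have E : T (n%:R * h) x - x = orbit_sum n h (T h x - x).
  rewrite /orbit_sum; elim: {n0}n => [|n IH].
    by rewrite big_ord0 mul0r T0 subrr.
  rewrite big_ord_recr /= -IH (contrB (cT (kh0 n h0'))) TD ?kh0//.
  rewrite -[in LHS]natr1 mulrDl mul1r.
  by rewrite addrC addrA subrK.
rewrite /dquot E /orbit_avg invfM -rscaleA; congr rscale.
rewrite /orbit_sum (rscale_sum M _ n (fun k => T (k%:R * h) (T h x - x))).
by apply: eq_bigr => k _; rewrite (contr_rscale (cT (kh0 k h0'))).
Qed.

(** The quotient of [u j] at t is an average of its quotients at t / (n + 1), hence close to the
    average of [v j], then to that of y, which is close to y for t below δ. Averages are
    contractions, so only the last comparison needs a normalised vector, namely y. *)
Lemma generator_closed_bounded (u v : nat -> S) x y :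
  ae P (fun w => nrm y w <= 1 / 2) ->
  (forall n, rlim (0 : R)^'+ (dquot^~ (u n)) (v n)) ->
  rlim \oo u x -> rlim \oo v y -> rlim (0 : R)^'+ (dquot^~ x) y.
Proof.
move=> y1 huv ux vy; apply/rlimP => e e0.
have e2 : 0 < e / 2 by rewrite divr_gt0.
have [δ δ0 hδ] := small_orbit y e2.
near=> t.
have t0 : 0 < t by near: t; exact: nbhs_right_gt.
have tδ : t < δ by near: t; exact: nbhs_right_lt.
apply: (@le_lt_trans _ _ (e / 2)); last by lra.
(* With t fixed, j tends to infinity; inside, with j fixed as well, n tends to infinity in [H'].
   Both error terms disappear and e / 2 remains. *)
have H : rdist (dquot t (u j) - dquot t x) + (rdist (v j - y) + e / 2)
    @[j --> \oo] --> (e / 2 : R).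
  rewrite -[X in _ --> X]add0r; apply: cvgD.
    exact: (rlim_dquot (ltW t0) ux).
  by rewrite -[X in _ --> X]add0r; apply: cvgD => //; exact: cvg_cst.
apply: (cvgr_to_ge H); apply: nearW => j.
apply: le_trans (rdist_tri M (dquot t (u j)) _ _) _.
rewrite (rdistC _ (dquot t x)) lerD2l.
have H' : rdist (dquot (t / n.+1%:R) (u j) - v j) + (rdist (v j - y) + e / 2)
    @[n --> \oo] --> (rdist (v j - y) + e / 2 : R).
  rewrite -[X in _ --> X]add0r; apply: cvgD; last exact: cvg_cst.
  exact: (rlim_right_div t0 (huv j)).
apply: (cvgr_to_ge H'); apply: nearW => n.
have h0 : 0 < t / n.+1%:R by rewrite divr_gt0.
have cA := orbit_avg_contr (ltW h0) (ltn0Sn n).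
have -> : dquot t (u j) = orbit_avg n.+1 (t / n.+1%:R) (dquot (t / n.+1%:R) (u j)).
  by rewrite -dquot_avg// mulrC divfK// pnatr_eq0.
apply: le_trans (rdist_tri M (orbit_avg n.+1 (t / n.+1%:R) (v j)) _ _) _.
apply: lerD; first by rewrite -(contrB cA); exact: rdist_contr.
apply: le_trans (rdist_tri M (orbit_avg n.+1 (t / n.+1%:R) y) _ _) _.
apply: lerD; first by rewrite -(contrB cA); exact: rdist_contr.
apply: orbit_avg_close => //; first exact: ltW.
move=> k kn; apply: hδ; rewrite kh0 ?(ltW h0)//=.
apply: le_lt_trans tδ; rewrite mulrA ler_pdivrMr// mulrC ler_wpM2l ?(ltW t0)//.
by rewrite ler_nat ltnW.
Unshelve. all: by end_near.
Qed.

Lemma generator_closed (u v : nat -> S) x y :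
  (forall n, rlim (0 : R)^'+ (dquot^~ (u n)) (v n)) ->
  rlim \oo u x -> rlim \oo v y -> rlim (0 : R)^'+ (dquot^~ x) y.
Proof.
move=> huv ux vy; have [c [c' [mc mc' cK y1]]] := normalizer y.
have dZ z : \forall t \near (0 : R)^'+, c *s dquot t z = dquot t (c *s z).
  by apply: filterS (nbhs_right_gt (0 : R)) => t /ltW t0; rewrite dquotZ.
have := @generator_closed_bounded (fun n => c *s u n) (fun n => c *s v n)
  (c *s x) (c *s y) y1.
have h n : rlim (0 : R)^'+ (dquot^~ (c *s u n)) (c *s v n).
  by apply: rlim_eq (rlimZ mc (huv n)); exact: dZ.
move=> /(_ h (rlimZ mc ux) (rlimZ mc vy)) /(rlimZ mc'); rewrite cK.
apply: rlim_eq; apply: filterS (nbhs_right_gt (0 : R)) => t /ltW t0.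
by rewrite -dquotZ ?cK.
Qed.

(* Riemann sums of [t^-1 * \int_0^t T(s) x ds] along dyadic partitions *)
Section dyadic_averages.
Variables (x : S) (t : R).
Hypothesis x1 : ae P (fun w => nrm x w <= 1 / 2).
Hypothesis t0 : 0 < t.

Let h j : R := t / (2 ^ j)%:R.
Let m j := orbit_avg (2 ^ j) (h j) x.

Let n0 j : (0 < 2 ^ j)%N. Proof. by rewrite expn_gt0. Qed.
Let n0R j : 0 < (2 ^ j)%:R :> R. Proof. by rewrite ltr0n. Qed.
Let h0 j : 0 < h j. Proof. by rewrite divr_gt0. Qed.
Let nh j : (2 ^ j)%:R * h j = t.
Proof. by rewrite mulrC divfK// lt0r_neq0. Qed.

Let h_cvg0 : h j @[j --> \oo] --> (0 : R).
Proof.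
rewrite -[X in _ --> X](mulr0 t); apply: cvgM; first exact: cvg_cst.
have : (2^-1 : R) ^+ n @[n --> \oo] --> (0 : R).
  by apply: cvg_expr; rewrite ger0_norm ?invr_ge0// invf_lt1//; lra.
by apply: cvg_trans; apply: near_eq_cvg; apply: nearW => n; rewrite exprVn natrX.
Qed.

Let h_small δ : 0 < δ -> \forall j \near \oo, h j < δ.
Proof.
move=> δ0; have /cvgr0Pnorm_lt/(_ _ δ0) := h_cvg0.
by apply: filterS => j; rewrite gtr0_norm.
Qed.

Let avg_close n k e δ : (forall s, 0 <= s < δ -> rdist (T s x - x) <= e) ->
  0 < k -> (0 < n)%N -> n%:R * k <= δ -> rdist (orbit_avg n k x - x) <= e.
Proof.
move=> hδ k0 n1 nk; apply: orbit_avg_close => //; first exact: ltW.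
move=> i ni; apply: hδ; rewrite kh0 ?(ltW k0)//=.
by apply: lt_le_trans nk; rewrite ltr_pM2r// ltr_nat.
Qed.

Lemma orbit_avg_comp n k l : 0 <= l ->
  orbit_avg (n * k) l x = orbit_avg n (k%:R * l) (orbit_avg k l x).
Proof.
move=> l0; rewrite /orbit_avg {2}/orbit_sum.
under eq_bigr => i _ do rewrite (contr_rscale (cT (kh0 i (kh0 k l0)))).
rewrite -(rscale_sum M _ n (fun i => T (i%:R * (k%:R * l)) (orbit_sum k l x))).
rewrite rscaleA natrM invfM; congr rscale.
elim: n => [|n IH]; first by rewrite mul0n /orbit_sum !big_ord0.
by rewrite mulSnr orbit_sum_add// IH big_ord_recr /= natrM mulrA.
Qed.

(** Refining the partition replaces x by its average over one coarse cell. The difference is an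
    average of a small vector as soon as the cell is shorter than δ. *)
Let m_sub j i : m (j + i) - m j =
  orbit_avg (2 ^ j) (h j) (orbit_avg (2 ^ i) (h (j + i)) x - x).
Proof.
rewrite (contrB (orbit_avg_contr (ltW (h0 j)) (n0 j))); congr (_ - _).
rewrite /m expnD orbit_avg_comp ?(ltW (h0 _))//; congr orbit_avg.
apply: (mulfI (lt0r_neq0 (n0R j))); rewrite nh mulrA -natrM -expnD.
exact: nh.
Qed.

Let hji j i : (2 ^ i)%:R * h (j + i) = h j.
Proof.
apply: (mulfI (lt0r_neq0 (n0R j))); rewrite nh mulrA -natrM -expnD.
exact: nh.
Qed.

Lemma dyadic_avg_cvg : RNcomplete M -> exists z, rlim \oo m z.
Proof.
move=> HC; apply: RNcomplete_cauchy => // e e0.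
have [δ δ0 hδ] := small_orbit x e0.
apply: filterS (h_small δ0) => j hj k jk; rewrite -(subnKC jk) m_sub.
apply: le_trans (rdist_contr (orbit_avg_contr (ltW (h0 j)) (n0 j)) _) _.
by apply: (avg_close hδ) => //; rewrite hji ltW.
Qed.

Lemma dyadic_avg_close z e δ : rlim \oo m z ->
  (forall s, 0 <= s < δ -> rdist (T s x - x) <= e) -> t <= δ ->
  rdist (z - x) <= e.
Proof.
move=> mz hδ tδ.
apply: (@rdist_lim_le _ _ _ _ _ M nat \oo _ (fun j => m j - x)).
  by apply: rlimB => //; exact: rlim_cst.
by apply: nearW => j; apply: (avg_close hδ) => //; rewrite nh.
Qed.

Let y := t^-1 *r (T t x - x).

(** For k h in place of s, the increment of the average over [0, t] equals that of T(t) on the sum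
    over [0, k h], up to scaling: the discrete form of exchanging s and t in the double integral.
    The two error terms come from rounding s to k h and from replacing the short sum by (s / h)
    x. *)
Let dquot_m s j : 0 < s -> let k := Num.truncn (s / h j) in
  let v := orbit_sum k (h j) x - (s / h j) *r x in
  dquot s (m j) - y = s^-1 *r (T s (m j) - T (k%:R * h j) (m j)) +
    (s * (2 ^ j)%:R)^-1 *r (T t v - v).
Proof.
move=> s0 k v.
have hj := ltW (h0 j); have kh := kh0 k hj.
pose n := (2 ^ j)%N; pose Sn := orbit_sum n (h j) x; pose Sk := orbit_sum k (h j) x.
have E1 : T (k%:R * h j) (m j) - m j = n%:R^-1 *r (T t Sk - Sk).
  rewrite /m /orbit_avg (contr_rscale (cT kh)) -rscaleBr; congr rscale.
  have := orbit_sum_add n k x hj; rewrite addnC orbit_sum_add// nh => E.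
  rewrite -/n -/Sn; apply: (@addrI _ (Sk + Sn)).
  transitivity (Sk + T (k%:R * h j) Sn); first by zmod.
  by rewrite E -/Sn -/Sk; zmod.
have E2 : y = (s * n%:R)^-1 *r (T t ((s / h j) *r x) - (s / h j) *r x).
  rewrite (contr_rscale (cT (ltW t0))) -rscaleBr rscaleA /y; congr rscale.
  have F (a b c : R) : a != 0 -> b != 0 -> c != 0 ->
      (a * b)^-1 = (c * a)^-1 * (c / b).
    by move=> a0 b0 c0; field; rewrite ?a0 ?b0 ?c0.
  by rewrite -[in t^-1](nh j); apply: F; exact: lt0r_neq0.
have -> : dquot s (m j) = s^-1 *r (T s (m j) - T (k%:R * h j) (m j)) +
    (s * n%:R)^-1 *r (T t Sk - Sk).
  rewrite invfM -rscaleA -E1 -rscaleDr /dquot; congr rscale.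
  by zmod.
rewrite E2 -addrA -rscaleBr; congr (_ + _ *r _).
rewrite /v (contrB (cT (ltW t0))) -/Sk.
by zmod.
Qed.

Let dquot_m_le s j : 0 < s -> h j <= s -> let k := Num.truncn (s / h j) in
  ae P (fun w => nrm (dquot s (m j) - y) w <=
    nrm (s^-1 *r T (s - k%:R * h j) x - s^-1 *r x) w +
    (nrm ((2 / t) *r (orbit_avg k (h j) x - x)) w +
     nrm ((2 * h j / (s * t)) *r x) w)).
Proof.
move=> s0 hs k; rewrite dquot_m// -/k -rscaleBr.
have hj := h0 j; have kh := kh0 k (ltW hj).
have s0' := ltW s0; have t0' := ltW t0.
have sh0 : 0 <= s / h j by rewrite divr_ge0// ltW.
have /andP[k1 k2] := truncn_itv sh0; rewrite -/k in k1 k2.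
have khs : k%:R * h j <= s by rewrite -ler_pdivlMr.
have k0 : (0 < k)%N by rewrite truncn_gt0 ler_pdivlMr// mul1r.
have k0R : k%:R != 0 :> R by rewrite pnatr_eq0 -lt0n.
have cA := orbit_avg_contr (ltW hj) (n0 j).
have E1 : s^-1 *r (T s (m j) - T (k%:R * h j) (m j)) =
    T (k%:R * h j) (orbit_avg (2 ^ j) (h j) (s^-1 *r (T (s - k%:R * h j) x - x))).
  rewrite (contr_rscale cA) (contr_rscale (cT kh)); congr rscale.
  rewrite (contrB cA) (contrB (cT kh)) -orbit_avg_commute ?subr_ge0 ?(ltW hj)//.
  by rewrite TD ?subr_ge0// [_ + (s - _)]addrC subrK.
pose kR : R := k%:R.
have E2 : orbit_sum k (h j) x - (s / h j) *r x =
    kR *r (orbit_avg k (h j) x - x) + (kR - s / h j) *r x.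
  rewrite rscaleBr rscaleBl /orbit_avg rscaleA divff// rscale1.
  by zmod.
set v := orbit_sum k (h j) x - (s / h j) *r x.
set c := (s * (2 ^ j)%:R)^-1.
have c0 : 0 <= c by rewrite invr_ge0 mulr_ge0.
have cE : c = h j / (s * t).
  have F (a b e : R) : a != 0 -> b != 0 -> e != 0 ->
      (a * b)^-1 = e / (a * (b * e)).
    by move=> a0 b0 e0; field; rewrite ?a0 ?b0 ?e0.
  by rewrite /c -[in s * t](nh j); apply: F; exact: lt0r_neq0.
(* The 2 comes from |T(t) v - v| <= 2 |v|, and c k = (k h / s) / t is at most 1 / t because k h <=
   s. *)
have ck : 2 * c * k%:R <= 2 / t.
  have F (a b e f : R) : e != 0 -> f != 0 ->
      2 * (a / (e * f)) * b = (2 / f) * (b * a / e).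
    by move=> e0 f0; field; rewrite ?e0 ?f0.
  rewrite cE F ?lt0r_neq0// -[leRHS]mulr1 ler_wpM2l ?divr_ge0//.
  by rewrite ler_pdivrMr// mul1r.
have hv : ae P (fun w => nrm v w <= k%:R * nrm (orbit_avg k (h j) x - x) w + nrm x w).
  rewrite /v E2.
  apply: filterS3 (rnormD M (kR *r (orbit_avg k (h j) x - x)) ((kR - s / h j) *r x))
    (nrm_rscale M kR (orbit_avg k (h j) x - x))
    (ae_and (nrm_rscale M (kR - s / h j) x) (rnorm_ge0 M x)) => w g1 g2 [g3 g4].
  rewrite (le_trans g1)// g2 g3 ger0_norm// lerD2l -[leRHS]mul1r ler_wpM2r//.
  rewrite ler0_norm ?subr_le0// opprB lerBlDr.
  by rewrite addrC natr1 ltW.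
have hTv : ae P (fun w => nrm (c *r (T t v - v)) w <= c * (2 * nrm v w)).
  apply: filterS3 (nrm_rscale M c (T t v - v)) (nrmB M (T t v) v)
    (contr_le (cT t0') v) => w -> g1 g2.
  by rewrite ger0_norm// ler_wpM2l//; lra.
have hW : ae P (fun w => nrm (s^-1 *r (T s (m j) - T (k%:R * h j) (m j))) w <=
    nrm (s^-1 *r (T (s - k%:R * h j) x - x)) w).
  by rewrite E1; exact: (contr_le (contr_comp (cT kh) cA)).
have h1 := rnormD M (s^-1 *r (T s (m j) - T (k%:R * h j) (m j))) (c *r (T t v - v)).
have h2 := nrm_rscale M (2 / t) (orbit_avg k (h j) x - x).
have h3 := nrm_rscale M (2 * h j / (s * t)) x.
have h4 := ae_and (rnorm_ge0 M (orbit_avg k (h j) x - x)) (rnorm_ge0 M x).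
have := ae_and (ae_and h1 h2) (ae_and h3 h4).
apply: filterS3 (ae_and hv hTv) hW => w [g1 g2] g3 [[g4 ->] [-> [g5 g6]]].
apply: le_trans g4 _; apply: lerD => //; apply: le_trans g2 _.
have g7 := ler_wpM2l c0 g1.
have g8 := ler_wpM2r g5 ck.
rewrite ger0_norm ?divr_ge0// ger0_norm; last first.
  by rewrite divr_ge0 ?mulr_ge0// ltW.
have -> : 2 * h j / (s * t) = 2 * c by rewrite -mulrA -cE.
by lra.
Qed.

Lemma dyadic_avg_generator z : rlim \oo m z ->
  rlim (0 : R)^'+ (dquot^~ z) y.
Proof.
(* [K] dominates the factor 2 / t and is at least 1, as [rho_scale] requires; the orbit accuracy e /
   (2 K) then contributes e / 2. *)
move=> mz; apply/rlimP => e e0; pose K := 1 + 2 / t.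
have K1 : 1 <= K by rewrite lerDl divr_ge0// ltW.
have K0 : 0 < K by lra.
have e1 : 0 < e / (2 * K) by rewrite divr_gt0// mulr_gt0.
have [δ δ0 hδ] := small_orbit x e1.
near=> s.
have s0 : 0 < s by near: s; exact: nbhs_right_gt.
have sδ : s < δ by near: s; exact: nbhs_right_lt.
apply: (@le_lt_trans _ _ (e / 2)); last by lra.
(* The remainder of s modulo the step; it is at most [h j], so T(r j) x tends to x while s stays
   fixed. *)
pose r j := s - (Num.truncn (s / h j))%:R * h j.
have rh j : 0 <= r j <= h j.
  have sh0 : 0 <= s / h j by rewrite divr_ge0// ltW.
  have /andP[k1 k2] := truncn_itv sh0.
  rewrite subr_ge0 -ler_pdivlMr// k1 /= lerBlDr -[X in X + _]mul1r -mulrDl.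
  by rewrite -ler_pdivrMr// addrC natr1 ltW.
have L1 : rlim \oo (fun j => s^-1 *r T (r j) x) (s^-1 *r x).
  apply: rlim_rscale; apply/rlimP => a a0.
  have a2 : 0 < a / 2 by rewrite divr_gt0.
  have [δ' δ'0 hδ'] := small_orbit x a2.
  apply: filterS (h_small δ'0) => j hj; have /andP[r0 r1] := rh j.
  apply: (@le_lt_trans _ _ (a / 2)); last by lra.
  by apply: hδ'; rewrite r0 (le_lt_trans r1).
have L2 : rlim \oo (fun j => (2 * h j / (s * t)) *r x) 0.
  apply: (@rlim_scal0 _ _ _ _ _ M _ _ _ (fun j => 2 * h j / (s * t)) (nrm x)).
  - exact: rnorm_meas.
  - rewrite -[X in _ --> X](mul0r (s * t)^-1); apply: cvgM; last exact: cvg_cst.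
    by rewrite -[X in _ --> X](mulr0 2); apply: cvgM => //; exact: cvg_cst.
  apply: nearW => j; rewrite subr0.
  by apply: filterS (nrm_rscale M (2 * h j / (s * t)) x) => w ->.
have H : rdist (dquot s (m j) - dquot s z) + (rdist (s^-1 *r T (r j) x - s^-1 *r x) +
    (e / 2 + rdist ((2 * h j / (s * t)) *r x - 0))) @[j --> \oo] --> (e / 2 : R).
  rewrite -[X in _ --> X]add0r; apply: cvgD.
    exact: (rlim_dquot (ltW s0) mz).
  rewrite -[X in _ --> X]add0r; apply: cvgD => //.
  by rewrite -[X in _ --> X]addr0; apply: cvgD => //; exact: cvg_cst.
apply: (cvgr_to_ge H); apply: filterS (h_small s0) => j /ltW hj.
apply: le_trans (rdist_tri M (dquot s (m j)) _ _) _.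
rewrite (rdistC _ (dquot s z)) lerD2l.
have /= hle := dquot_m_le s0 hj.
set k := Num.truncn (s / h j) in hle.
set a := s^-1 *r T _ x - _ in hle; set b := (2 / t) *r _ in hle.
set c := (2 * h j / _) *r x in hle.
have mb : rmeas (fun w => nrm b w + nrm c w).
  by apply: measurable_funD; exact: rnorm_meas.
apply: (@le_trans _ _ (rdist a + rho P (fun w => nrm b w + nrm c w))).
  apply: rho_le_add => //; try exact: rnorm_meas.
  apply: filterS2 hle (rnorm_ge0 M (dquot s (m j) - y)) => w g1 g2.
  by rewrite ger0_norm// (le_trans g1)// lerD// ler_norm.
rewrite -/(r j) -/k -/a lerD2l subr0 -/c.
apply: (@le_trans _ _ (rdist b + rdist c)).
  apply: rho_le_add => //; try exact: rnorm_meas.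
  by apply: aeW => w; exact: ler_normD.
rewrite lerD2r; apply: (@le_trans _ _ (K * rdist (orbit_avg k (h j) x - x))).
  apply: rho_scale => //; try exact: rnorm_meas.
  apply: filterS2 (nrm_rscale M (2 / t) (orbit_avg k (h j) x - x))
    (rnorm_ge0 M (orbit_avg k (h j) x - x)) => w ->.
  move=> g; rewrite normrM normr_id ler_wpM2r// ger0_norm ?divr_ge0 ?(ltW t0)//.
  by rewrite /K; lra.
rewrite (_ : e / 2 = K * (e / (2 * K))); last first.
  have F (p q : R) : q != 0 -> p / 2 = q * (p / (2 * q)).
    by move=> q0; field; rewrite ?q0.
  by apply: F; exact: lt0r_neq0.
rewrite ler_pM2l//; apply: (avg_close hδ) => //.
  by rewrite truncn_gt0 ler_pdivlMr// mul1r.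
have /andP[+ _] := rh j; rewrite subr_ge0 -/k => /le_trans; apply.
exact: ltW.
Unshelve. all: by end_near.
Qed.

End dyadic_averages.

Lemma generator_dense x e : RNcomplete M -> 0 < e ->
  exists z y, rlim (0 : R)^'+ (dquot^~ z) y /\ rdist (z - x) < e.
Proof.
move=> HC e0; have [c [c' [mc mc' cK x1]]] := normalizer x.
pose Q (z : S) := exists y, rlim (0 : R)^'+ (dquot^~ z) y.
have hQ a : 0 < a -> exists2 z, Q z & rdist (z - c *s x) <= a.
  move=> a0; have [δ δ0 hδ] := small_orbit (c *s x) a0.
  have [z mz] := dyadic_avg_cvg x1 δ0 HC.
  exists z; last exact: (dyadic_avg_close x1 δ0 mz hδ).
  by eexists; exact: (dyadic_avg_generator x1 δ0 mz).
(* A whole sequence is taken because multiplication by the possibly unbounded [c'] is continuous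
   without being Lipschitz for the metric. *)
have /choice[u hu] : forall n : nat, exists z, Q z /\ rdist (z - c *s x) <= n.+1%:R^-1.
  move=> n; have n0 : 0 < n.+1%:R^-1 :> R by rewrite invr_gt0.
  by have [z Qz hz] := hQ _ n0; exists z.
have ux : rlim \oo u (c *s x).
  apply: (rlim_squeeze _ (@cvg_harmonic R)); apply: nearW => n.
  by case: (hu n).
have {}ux : rlim \oo (fun n => c' *s u n) x by rewrite -(cK x); exact: rlimZ.
have /rlimP/(_ _ e0)[n _ /(_ n (leqnn _)) /= hn] := ux.
have [[y hy] _] := hu n.
exists (c' *s u n), (c' *s y); split => //.
apply: rlim_eq (rlimZ mc' hy).
by apply: filterS (nbhs_right_gt (0 : R)) => t /ltW t0; rewrite dquotZ.
Qed.

End contraction_semigroup.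

(** * Resolvents of the generator of a contraction semigroup *)

Section generator_resolvent.
Context (R : realType) (d : measure_display) (Ω : measurableType d)
        (P : probability Ω R) (S : zmodType) (M : RNModule P S).
Local Notation nrm := (rnorm M).
Local Notation "xi *s x" := (smul M xi x) (at level 40).
Local Notation "t *r x" := (rscale M t x) (at level 40).
Local Notation rdist := (rdist M).
Local Notation rlim := (rlim M).
Implicit Types (x y z : S) (s t h : R).

Variable T : R -> S -> S.
Hypothesis cT : forall t, 0 <= t -> contraction M (T t).
Hypothesis T0 : forall x, T 0 x = x.
Hypothesis TD : forall s t x, 0 <= s -> 0 <= t -> T s (T t x) = T (s + t) x.
Hypothesis Tc : forall x, rlim (0 : R)^'+ (fun t => T t x) x.

Local Notation dquot := (dquot M T).
(** The graph of the generator as a relation, usable without a chosen operator and domain; it later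
    serves for a semigroup whose generator is not yet identified. *)
Definition gen x y := rlim (0 : R)^'+ (dquot^~ x) y.

Lemma gen_sub x x' y y' : gen x y -> gen x' y' -> gen (x - x') (y - y').
Proof.
move=> h h'; apply: rlim_eq (rlimB h h').
by apply: filterS (nbhs_right_gt (0 : R)) => t /ltW t0; rewrite (dquotB cT).
Qed.

Lemma gen_add x x' y y' : gen x y -> gen x' y' -> gen (x + x') (y + y').
Proof.
move=> h h'; have h0 : gen 0 0.
  by have := gen_sub h h; rewrite !subrr.
by have := gen_sub h (gen_sub h0 h'); rewrite !sub0r !opprK.
Qed.

Lemma gen_smul xi x y : cmeas xi -> gen x y -> gen (xi *s x) (xi *s y).
Proof.
move=> m h; apply: rlim_eq (rlimZ m h).
by apply: filterS (nbhs_right_gt (0 : R)) => t /ltW t0; rewrite (dquotZ cT).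
Qed.

Lemma gen_dissipative xi x y : cmeas xi -> gen x y ->
  ae P (fun w => complex.Re (xi w) * nrm x w <= nrm (xi *s x - y) w).
Proof.
move=> m h; pose f w := complex.Re (xi w) * nrm x w - nrm (xi *s x - y) w.
have mf : rmeas f.
  apply: measurable_funB; last exact: rnorm_meas.
  by apply: measurable_funM; [case: m|exact: rnorm_meas].
have : ae P (fun w => f w <= 0).
  apply: (@ae_le0_lim _ _ _ P _ _ _ f (fun t => nrm (dquot t x - y))) h => //.
    by move=> t; exact: rnorm_meas.
  apply: filterS (nbhs_right_gt (0 : R)) => t t0.
  have := nrm_dist_tri M y (xi *s x) (dquot t x).
  apply: filterS3 (dquot_dissipative cT x t0 m) (nrm_distC M y (dquot t x)).
  move=> w h1 h2 h3; apply: le_trans (ler_norm _).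
  by rewrite /f; lra.
by apply: filterS => w; rewrite subr_le0.
Qed.

Section resolvent.
Variable xi : Ω -> R[i].
Hypothesis mxi : cmeas xi.
Hypothesis xi0 : ae P (fun w => 0 < complex.Re (xi w)).

Let B w := (complex.Re (xi w))^-1.
Let mB : rmeas B. Proof. by apply: rmeasV; case: mxi. Qed.
Let B0 : ae P (fun w => 0 <= B w).
Proof. by apply: filterS xi0 => w h; rewrite invr_ge0 ltW. Qed.

Lemma gen_bound x y : gen x y ->
  ae P (fun w => nrm x w <= B w * nrm (xi *s x - y) w).
Proof.
move=> h; apply: filterS2 xi0 (gen_dissipative mxi h) => w p.
by rewrite ler_pdivlMl.
Qed.

Lemma gen_inj x x' y y' : gen x y -> gen x' y' ->
  xi *s x - y = xi *s x' - y' -> x = x'.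
Proof.
move=> h h' e; apply/eqP; rewrite -subr_eq0; apply/eqP/(rnorm_eq0 (r := M)).
have e0 : xi *s (x - x') - (y - y') = 0.
  rewrite smulBr//; transitivity (xi *s x - y - (xi *s x' - y')); first by zmod.
  by rewrite e subrr.
have := gen_bound (gen_sub h h'); rewrite e0.
apply: filterS3 (nrm0 M) (rnorm_ge0 M (x - x')) => w -> p.
by rewrite mulr0 => q; apply/eqP; rewrite eq_le q.
Qed.

Let dquot_bound t x : 0 < t ->
  ae P (fun w => nrm x w <= B w * nrm (xi *s x - dquot t x) w).
Proof.
move=> t0; apply: filterS2 xi0 (dquot_dissipative cT x t0 mxi) => w p.
by rewrite ler_pdivlMl.
Qed.

(** The equation is equivalent to x = (1 + h xi)^-1 (T(h) x + h y), whose right-hand side contracts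
    with the random ratio 1 / |1 + h xi| < 1. *)
Lemma dquot_resolvent h y : RNcomplete M -> 0 < h ->
  exists x, xi *s x - dquot h x = y.
Proof.
move=> HC h0; pose eta w := 1 + h%:C%C * xi w.
have mh : cmeas (cst h%:C%C : Ω -> R[i]) by exact: cmeas_cst.
have meta : cmeas eta.
  apply: cmeasD; first exact: (@cmeas_cst _ _ _ 1).
  exact: (cmeasM mh).
have mV := cmeasV meta.
have eta1 : ae P (fun w => 1 < cabs (eta w)).
  apply: filterS xi0 => w p; apply: lt_le_trans (Re_le_cabs _).
  rewrite /eta ReD /= ltrDl; case: (xi w) p => a b /= p.
  by rewrite mul0r subr0 mulr_gt0.
have [||x y' |x ex] := @random_fixed_point _ _ _ _ _ M
    (fun x => (fun w => (eta w)^-1) *s (T h x + h *r y))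
    (fun w => cabs (eta w)^-1) HC.
- exact: rmeas_cabs.
- apply: filterS eta1 => w p; rewrite cabs_ge0 /= cabsV invf_lt1//.
  by rewrite (lt_trans _ p).
- rewrite -smulBr// (_ : _ - _ = T h (x - y')); last first.
    by rewrite (contrB (cT (ltW h0))); zmod.
  apply: filterS2 (rnormZ M (T h (x - y')) mV) (contr_le (cT (ltW h0)) (x - y')).
  by move=> w -> p; rewrite ler_wpM2l// cabs_ge0.
exists x; have E := rscale_resolvent_dquot M T x h0 mxi.
have e1 : eta *s x = T h x + h *r y.
  rewrite -{1}ex smulA// -[RHS](smul1 M); apply: smul_ae.
  - exact: cmeasM.
  - exact: (@cmeas_cst _ _ _ 1).
  apply: filterS eta1 => w p; rewrite mulfV// -cabs_eq0 lt0r_neq0//.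
  by rewrite (lt_trans _ p).
have : h *r (xi *s x - dquot h x) = h *r y by rewrite E e1 addrC addKr.
by move/(congr1 (rscale M h^-1)); rewrite !rscaleA mulVf ?lt0r_neq0// !rscale1.
Qed.

(** Quotients at different steps commute, so their difference applied to x solves the same resolvent
    equation with y replaced by that difference applied to y. *)
Let dquot_swap s h x y : 0 < s -> 0 < h -> xi *s x - dquot h x = y ->
  ae P (fun w => nrm (dquot s x - dquot h x) w <=
    B w * nrm (dquot s y - dquot h y) w).
Proof.
move=> s0 h0 <-; have := dquot_bound (dquot s x - dquot h x) h0.
rewrite (_ : xi *s (dquot s x - dquot h x) - _ = dquot s (xi *s x - dquot h x) -
  dquot h (xi *s x - dquot h x))//.
rewrite smulBr// !(dquotB cT _ _ (ltW s0)) !(dquotB cT _ _ (ltW h0)).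
rewrite (dquotZ cT x (ltW s0) mxi) (dquotZ cT x (ltW h0) mxi).
by rewrite (dquotC cT TD _ (ltW h0) (ltW s0)); zmod.
Qed.

(** If u_n solves the equation with step a_n, then u_m - u_n solves the one with step a_m for the
    right-hand side (A_m - A_n) u_n. Dissipativity is used twice, here and in moving A_m - A_n from
    u_n to y, whence the factor B^2. Since y is in the domain, its quotients converge. *)
Lemma gen_resolvent_dom y y' : RNcomplete M -> gen y y' ->
  exists x, gen x (xi *s x - y).
Proof.
move=> HC gy; pose a (n : nat) : R := 1 / n.+1%:R.
have a0 n : 0 < a n by rewrite divr_gt0.
have ay : rlim \oo (fun n => dquot (a n) y) y' := rlim_right_div ltr01 gy.
have /choice[u hu] : forall n, exists x, xi *s x - dquot (a n) x = y.
  by move=> n; exact: dquot_resolvent.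
have mBB : rmeas (fun w => B w * B w) by exact: measurable_funM.
have [m n|x ux] := @RNcomplete_transfer _ _ _ _ _ M u (fun n => dquot (a n) y) y'
    (fun w => B w * B w) HC mBB ay.
  have := dquot_bound (u m - u n) (a0 m).
  rewrite (_ : xi *s _ - _ = dquot (a m) (u n) - dquot (a n) (u n)); last first.
    rewrite smulBr// (dquotB cT _ _ (ltW (a0 m))).
    transitivity (xi *s u m - dquot (a m) (u m) -
      (xi *s u n - dquot (a n) (u n)) + (dquot (a m) (u n) - dquot (a n) (u n))).
      by zmod.
    by rewrite !hu subrr add0r.
  apply: filterS3 B0 (dquot_swap (a0 m) (a0 n) (hu n)) => w b h1 h2.
  by rewrite (le_trans h2)// -mulrA ler_wpM2l.
exists x; apply: (rlim_bound mB _ gy).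
apply: filterS (nbhs_right_gt (0 : R)) => s s0.
(* For fixed s the limit in n bounds the distance from the quotient of x to xi x - y by B times the
   distance from the quotient of y to y', and the latter tends to 0 with s. *)
have L : rlim \oo (fun n => dquot s (u n) - (xi *s u n - y))
    (dquot s x - (xi *s x - y)).
  apply: rlimB; first exact: (rlim_dquot cT (ltW s0)).
  by apply: rlimB; [exact: rlimZ|exact: rlim_cst].
apply: (nrm_lim_le L ay _ mB).
  by apply: measurable_funM => //; exact: rnorm_meas.
apply: nearW => n.
rewrite (_ : xi *s u n - y = dquot (a n) (u n)); last by rewrite -[in LHS](hu n); zmod.
have := nrm_dist_tri M y' (dquot s y) (dquot (a n) y).
apply: filterS3 (ae_and B0 (nrm_distC M y' (dquot (a n) y)))
  (dquot_swap s0 (a0 n) (hu n)) => w [b h0] h1 h2.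
by rewrite (le_trans h1)// -mulrDr ler_wpM2l// -h0.
Qed.

Lemma gen_resolvent y : RNcomplete M -> exists x, gen x (xi *s x - y).
Proof.
move=> HC; have dD : RNdense M [set z | exists z', gen z z'].
  apply/RNdenseP => z e e0.
  by have [z' [z'' [h1 h2]]] := generator_dense cT T0 TD Tc z HC e0;
    exists z' => //; exists z''.
have [v Dv vy] := RNdense_seq y dD.
have /choice[u hu] : forall n, exists x, gen x (xi *s x - v n).
  by move=> n; have [z hz] := Dv n; exact: gen_resolvent_dom hz.
have [m n|x ux] := @RNcomplete_transfer _ _ _ _ _ M u v y B HC mB vy.
  have := gen_bound (gen_sub (hu m) (hu n)).
  by rewrite (_ : xi *s _ - _ = v m - v n)// smulBr//; zmod.
exists x; apply: (generator_closed cT T0 TD Tc hu ux).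
by apply: rlimB => //; exact: rlimZ.
Qed.

End resolvent.

Section generator.
Variables (D : set S) (A : S -> S).
Hypothesis HC : RNcomplete M.
Hypothesis D_gen : forall x, D x <-> exists y, gen x y.
Hypothesis A_gen : forall x, D x -> gen x (A x).

Lemma generator_closed_op : closed_op M D A.
Proof.
apply: closed_op_intro => u x y Du ux Auy.
have g : gen x y.
  by apply: (generator_closed cT T0 TD Tc _ ux Auy) => n; exact: A_gen.
have Dx : D x by apply/D_gen; exists y.
by split => //; exact: rlim_unique (A_gen Dx) g.
Qed.

Lemma generator_RNdense : RNdense M D.
Proof.
apply/RNdenseP => x e e0.
have [z [y [h1 h2]]] := generator_dense cT T0 TD Tc x HC e0.
by exists z => //; apply/D_gen; exists y.
Qed.

Lemma generator_resolvent xi : cmeas xi ->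
  ae P (fun w => 0 < complex.Re (xi w)) ->
  exists Rxi, is_resolvent M D A xi Rxi /\
    opnorm_le M Rxi (fun w => (complex.Re (xi w))^-1).
Proof.
move=> mxi xi0.
have /choice[Q hQ] : forall y, exists x, gen x (xi *s x - y).
  by move=> y; exact: gen_resolvent.
have inj := gen_inj mxi xi0.
(* Uniqueness of the solution turns the mere choice [Q] into a two-sided inverse and a module
   homomorphism. *)
have QE x y : gen x (xi *s x - y) -> Q y = x.
  move=> h; apply: (inj _ _ _ _ (hQ y) h).
  by zmod.
have Qb y : ae P (fun w => nrm (Q y) w <= (complex.Re (xi w))^-1 * nrm y w).
  have := gen_bound mxi xi0 (hQ y).
  by rewrite (_ : xi *s Q y - _ = y)//; zmod.
have mB : rmeas (fun w => (complex.Re (xi w))^-1) by apply: rmeasV; case: mxi.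
exists Q; split; last first.
  apply: opnorm_le_intro; split => //; split => //.
  by apply: filterS xi0 => w h; rewrite invr_ge0 ltW.
split; [|split].
- move=> x Dx; apply: QE.
  by rewrite (_ : xi *s x - _ = A x); [exact: A_gen|zmod].
- move=> y; have DQ : D (Q y) by apply/D_gen; eexists; exact: hQ.
  split => //; rewrite (rlim_unique (A_gen DQ) (hQ y)).
  by zmod.
apply: (bounded_op_intro _ mB Qb); split.
- move=> x y _ _; apply: QE; rewrite smulDr//.
  have := gen_add (hQ x) (hQ y).
  by rewrite (_ : xi *s Q x - x + _ = xi *s Q x + xi *s Q y - (x + y))//; zmod.
- move=> eta x m _; apply: QE.
  have := gen_smul m (hQ x); rewrite smulBr// (smulC M _ m mxi).
  exact.
Qed.

End generator.

End generator_resolvent.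

(** * The semigroup as a limit of powers of resolvents *)

Section exponential_formula.
Context (R : realType) (d : measure_display) (Ω : measurableType d)
        (P : probability Ω R) (S : zmodType) (M : RNModule P S).
Local Notation nrm := (rnorm M).
Local Notation "xi *s x" := (smul M xi x) (at level 40).
Local Notation "t *r x" := (rscale M t x) (at level 40).
Local Notation rdist := (rdist M).
Local Notation rlim := (rlim M).
Implicit Types (x y z : S) (s t h k : R).

Variables (D : set S) (A : S -> S) (J : R -> S -> S).
Hypothesis HC : RNcomplete M.
Hypothesis HD : submodule M D.
Hypothesis HA : modhom_on M D A.
Hypothesis dD : RNdense M D.
Hypothesis cJ : forall h, 0 < h -> contraction M (J h).
Hypothesis DJ : forall h y, 0 < h -> D (J h y).
Hypothesis JK : forall h y, 0 < h -> J h y - h *r A (J h y) = y.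
Hypothesis KJ : forall h x, 0 < h -> D x -> J h (x - h *r A x) = x.

Let AB x y : D x -> D y -> A (x - y) = A x - A y.
Proof. exact: (modhomB HD HA). Qed.

Let Ar t x : D x -> A (t *r x) = t *r A x.
Proof. by case: HA => _ h Dx; apply: h => //; exact: cmeas_cst. Qed.

Let Dr t x : D x -> D (t *r x).
Proof. by case: HD => _ [_ h] Dx; apply: h => //; exact: cmeas_cst. Qed.

Let DB x y : D x -> D y -> D (x - y).
Proof.
move=> Dx Dy; rewrite -[y](rscale1 M) -rscaleNl.
by case: HD => _ [h _]; apply: h => //; exact: Dr.
Qed.

Lemma AJE h y : 0 < h -> A (J h y) = h^-1 *r (J h y - y).
Proof.
move=> h0; rewrite -{3}(JK y h0) opprB addrC subrK rscaleA mulVf ?rscale1//.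
exact: lt0r_neq0.
Qed.

Lemma AJ h x : 0 < h -> D x -> A (J h x) = J h (A x).
Proof.
move=> h0 Dx; have DJx := DJ x h0.
(* Since x is in the domain, so is A J x = (J x - x) / h, and A may be applied to the resolvent
   equation itself. *)
have DA : D (A (J h x)) by rewrite AJE//; apply: Dr; exact: DB.
have {2}-> : x = J h x - h *r A (J h x) by rewrite JK.
by rewrite AB ?Ar ?KJ//; exact: Dr.
Qed.

Lemma J_sub h x : 0 < h -> D x -> J h x - x = h *r J h (A x).
Proof.
move=> h0 Dx; rewrite -AJ// AJE// rscaleA divff ?rscale1//; exact: lt0r_neq0.
Qed.

Lemma J_close h x : 0 < h -> D x ->
  ae P (fun w => nrm (J h x - x) w <= h * nrm (A x) w).
Proof.
move=> h0 Dx; rewrite J_sub//.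
apply: filterS2 (nrm_rscale M h (J h (A x))) (contr_le (cJ h0) (A x)) => w -> p.
by rewrite gtr0_norm// ler_pM2l.
Qed.

Lemma iterJ n h x : 0 < h -> D x ->
  D (iter n (J h) x) /\ A (iter n (J h) x) = iter n (J h) (A x).
Proof.
move=> h0 Dx; elim: n => [//|n [IH1 IH2]] /=.
by split; [exact: DJ|rewrite AJ// IH2].
Qed.

Lemma iterJ_step n h x : 0 < h -> D x ->
  ae P (fun w => nrm (iter n.+1 (J h) x - iter n (J h) x) w <= h * nrm (A x) w).
Proof.
move=> h0 Dx; rewrite iterSr.
have cI := contr_iter n (cJ h0); rewrite -(contrB cI).
apply: filterS2 (contr_le cI (J h x - x)) (J_close h0 Dx) => w p q.
exact: le_trans q.
Qed.

Definition D2 x := D x /\ D (A x).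

(** With v = J_k J_k x one has x = (I - kA)^2 v = (I - 2kA) v + k^2 A^2 v. Applying J_2k shows that
    the difference is exactly k^2 J_2k A^2 v. *)
Lemma J_half k x : 0 < k -> D2 x ->
  ae P (fun w => nrm (J (2 * k) x - J k (J k x)) w <= k ^+ 2 * nrm (A (A x)) w).
Proof.
move=> k0 [Dx DAx]; have k20 : 0 < 2 * k by lra.
pose v := J k (J k x).
have Dv : D v by exact: DJ.
have Av : A v = J k (J k (A x)) by rewrite /v !AJ//; exact: DJ.
have DAv : D (A v) by rewrite Av; exact: DJ.
have AAv : A (A v) = J k (J k (A (A x))) by rewrite Av !AJ//; exact: DJ.
have E : x = v - (2 * k) *r A v + (k ^+ 2) *r A (A v).
  have e1 : J k x = v - k *r A v by rewrite /v JK.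
  rewrite -[LHS](JK x k0) e1 AB ?Ar//; last exact: Dr.
  rewrite rscaleBr rscaleA -expr2 mulr_natl mulr2n rscaleDl.
  by zmod.
have -> : J (2 * k) x - v = (k ^+ 2) *r J (2 * k) (A (A v)).
  by rewrite E (contrD (cJ k20)) KJ// (contr_rscale (cJ k20)); zmod.
have c3 := contr_comp (cJ k20) (contr_comp (cJ k0) (cJ k0)).
apply: filterS2 (nrm_rscale M (k ^+ 2) (J (2 * k) (A (A v)))) (contr_le c3 (A (A x))).
move=> w -> p; rewrite ger0_norm ?sqr_ge0// ler_wpM2l ?sqr_ge0//.
by rewrite AAv.
Qed.

(** Each step adds at most k^2 |A^2 x|: earlier errors are carried along by contractions, and A^2
    commutes with the iterates. *)
Lemma iterJ_half n k x : 0 < k -> D2 x ->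
  ae P (fun w => nrm (iter n (J (2 * k)) x - iter n.*2 (J k) x) w <=
    n%:R * k ^+ 2 * nrm (A (A x)) w).
Proof.
move=> k0 [Dx DAx]; have k20 : 0 < 2 * k by lra.
elim: n => [|n IH].
  by rewrite /= subrr; apply: filterS (nrm0 M) => w ->; rewrite !mul0r.
set z := iter n.*2 (J k) x.
have [Dz Az] := iterJ n.*2 k0 Dx.
have [DAz AAz] := iterJ n.*2 k0 DAx.
have D2z : D2 z by split => //; rewrite Az.
have -> : iter n.+1 (J (2 * k)) x - iter n.+1.*2 (J k) x =
    J (2 * k) (iter n (J (2 * k)) x - z) + (J (2 * k) z - J k (J k z)).
  by rewrite (contrB (cJ k20)) /= -/z; zmod.
have hz := contr_le (contr_iter n.*2 (cJ k0)) (A (A x)).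
rewrite -AAz -Az -/z in hz.
have h12 := ae_and (rnormD M (J (2 * k) (iter n (J (2 * k)) x - z))
  (J (2 * k) z - J k (J k z))) (J_half k0 D2z).
have h3 := contr_le (cJ k20) (iter n (J (2 * k)) x - z).
apply: filterS3 h12 h3 (ae_and IH hz) => w [h1 h2] {}h3 [h4 h5].
have h6 := ler_wpM2l (sqr_ge0 k) h5; rewrite -/z in h4.
have -> : n.+1%:R * k ^+ 2 = n%:R * k ^+ 2 + k ^+ 2.
  by rewrite -natr1 mulrDl mul1r.
by lra.
Qed.

Let nat_le (a b : nat) k : 0 < k -> a%:R * k < b%:R * k + k -> (a <= b)%N.
Proof.
move=> k0 h; rewrite -ltnS -(ltr_nat R) -(ltr_pM2r k0).
by rewrite -[in b.+1%:R]natr1 mulrDl mul1r.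
Qed.

(** This is the cost of rounding: step counts obtained by truncation at two scales, or for a sum of
    times, differ by at most one. *)
Lemma iterJ_near a b h x : 0 < h -> D x -> (a <= b <= a.+1)%N ->
  ae P (fun w => nrm (iter b (J h) x - iter a (J h) x) w <= h * nrm (A x) w).
Proof.
move=> h0 Dx /andP[ab]; rewrite leq_eqVlt => /predU1P[->|ba].
  exact: iterJ_step.
have -> : b = a by apply/eqP; rewrite eqn_leq ab andbT -ltnS.
rewrite subrr; apply: filterS2 (nrm0 M) (rnorm_ge0 M (A x)) => w -> p.
by rewrite mulr_ge0// ltW.
Qed.

Lemma iterJ_close n h x : 0 < h -> D x ->
  ae P (fun w => nrm (iter n (J h) x - x) w <= n%:R * h * nrm (A x) w).
Proof.
move=> h0 Dx; elim: n => [|n IH].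
  by rewrite subrr; apply: filterS (nrm0 M) => w ->; rewrite !mul0r.
apply: filterS3 (nrm_dist_tri M (iter n (J h) x) (iter n.+1 (J h) x) x)
  (iterJ_step n h0 Dx) IH => w h1 h2 h3.
rewrite -[in n.+1%:R]natr1 !mulrDl mul1r.
by move: h1 h2 h3; lra.
Qed.

(** The errors satisfy e_(n+1) = J e_n + (n + 1) h (J A x - A x), so each step adds at most (n + 1)
    h^2 |A^2 x|, and n^2 + (n + 1) <= (n + 1)^2 closes the induction. *)
Lemma iterJ_taylor n h x : 0 < h -> D2 x ->
  ae P (fun w => nrm (iter n (J h) x - x - (n%:R * h) *r A x) w <=
    (n%:R * h) ^+ 2 * nrm (A (A x)) w).
Proof.
move=> h0 [Dx DAx]; elim: n => [|n IH].
  rewrite mul0r rscale0 !subrr.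
  by apply: filterS (nrm0 M) => w ->; rewrite expr0n mul0r.
set e := iter n (J h) x - x - (n%:R * h) *r A x.
pose c := n.+1%:R * h.
have -> : iter n.+1 (J h) x - x - (n.+1%:R * h) *r A x =
    J h e + c *r (J h (A x) - A x).
  have -> : c = h + n%:R * h by rewrite /c -[in LHS]natr1 mulrDl mul1r addrC.
  rewrite -natr1 mulrDl mul1r /e !(contrB (cJ h0)) (contr_rscale (cJ h0)) /=.
  rewrite !rscaleDl !rscaleBr -J_sub//.
  by zmod.
have c0 : 0 <= c by rewrite mulr_ge0// ltW.
have h1 := ae_and (rnormD M (J h e) (c *r (J h (A x) - A x)))
  (nrm_rscale M c (J h (A x) - A x)).
have h2 := ae_and (contr_le (cJ h0) e) (J_close h0 DAx).
apply: filterS3 h1 h2 (ae_and IH (rnorm_ge0 M (A (A x)))).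
move=> w [g1 g2] [g3 g4] [g5 g6].
have g7 := ler_wpM2l c0 g4.
have E : c = n%:R * h + h by rewrite /c -[in LHS]natr1 mulrDl mul1r.
have n0 : 0 <= n%:R * h by rewrite mulr_ge0// ltW.
have g8 : 0 <= (n%:R * h) * h * nrm (A (A x)) w by rewrite !mulr_ge0// ltW.
move: g1; rewrite g2 (ger0_norm c0) -/c -/e in g5 *; move: g7 g8.
rewrite E expr2; move: (n%:R * h) n0 g5 => m n0; rewrite -expr2 => g5 g7 g8 g1.
by nra.
Qed.

Lemma J_D2 h x : 0 < h -> D x -> D2 (J h x).
Proof.
move=> h0 Dx; split; first exact: DJ.
by rewrite AJE//; apply: Dr; apply: DB => //; exact: DJ.
Qed.

Lemma J_lim x : rlim \oo (fun n : nat => J n.+1%:R^-1 x) x.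
Proof.
have h0 n : 0 < n.+1%:R^-1 :> R by rewrite invr_gt0.
have hD z : D z -> rlim \oo (fun n : nat => J n.+1%:R^-1 z) z.
  move=> Dz; apply: (@rlim_scal0 _ _ _ _ _ M _ _ _ (fun n => n.+1%:R^-1) (nrm (A z))).
  - exact: rnorm_meas.
  - exact: cvg_harmonic.
  by apply: nearW => n; rewrite gtr0_norm//; exact: J_close.
apply/rlimP => e e0; have e3 : 0 < e / 3 by rewrite divr_gt0.
have /RNdenseP/(_ x _ e3)[z Dz hz] := dD.
have /rlimP/(_ _ e3) := hD z Dz; apply: filterS => n hn.
have := rdist_contr (cJ (h0 n)) (x - z); rewrite (contrB (cJ (h0 n))).
have := rdist_tri M (J n.+1%:R^-1 z) (J n.+1%:R^-1 x) x.
have := rdist_tri M z (J n.+1%:R^-1 z) x.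
rewrite (rdistC _ x z); move: hn hz.
by lra.
Qed.

Lemma D2_dense : RNdense M [set x | D2 x].
Proof.
apply/RNdenseP => x e e0; have e2 : 0 < e / 2 by rewrite divr_gt0.
have /RNdenseP/(_ x _ e2)[z Dz hz] := dD.
have /rlimP/(_ _ e2)[n _ /(_ n (leqnn _)) /= hn] := J_lim z.
exists (J n.+1%:R^-1 z); first by apply: J_D2 => //; rewrite invr_gt0.
by have := rdist_tri M z (J n.+1%:R^-1 z) x; lra.
Qed.

Let hp j : R := 2^-1 ^+ j.
Let hp0 j : 0 < hp j. Proof. by rewrite exprn_gt0// invr_gt0. Qed.
Let hpS j : hp j = 2 * hp j.+1.
Proof. by rewrite /hp exprS mulrA mulfV// mul1r. Qed.
Let hp_cvg0 : hp j @[j --> \oo] --> (0 : R).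
Proof.
by apply: cvg_expr; rewrite ger0_norm ?invr_ge0// invf_lt1//; lra.
Qed.

Let N j t := Num.truncn (t / hp j).
Let U j t := iter (N j t) (J (hp j)).

Let cU j t : contraction M (U j t).
Proof. exact/contr_iter/cJ. Qed.

Let N_itv j t : 0 <= t -> (N j t)%:R * hp j <= t < (N j t)%:R * hp j + hp j.
Proof.
move=> t0; have th : 0 <= t / hp j by rewrite divr_ge0// ltW.
have /andP[h1 h2] := truncn_itv th.
rewrite -ler_pdivlMr// h1 /= -[X in _ + X]mul1r -mulrDl natr1.
by rewrite -ltr_pdivrMr.
Qed.

(** Halving the step turns n steps into 2n or 2n + 1. Doubling costs n k^2 <= t k times |A^2 x| and
    the possible extra step costs k |A x|, so the increments decay like 2^-j. *)
Let U_step j t x : 0 <= t -> D2 x ->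
  ae P (fun w => nrm (U j.+1 t x - U j t x) w <=
    2^-1 ^+ j * ((1 + t) * (nrm (A (A x)) w + nrm (A x) w))).
Proof.
move=> t0 D2x; have [Dx DAx] := D2x.
have /andP[a1 a2] := N_itv j t0; have /andP[b1 b2] := N_itv j.+1 t0.
set n := N j t; set n' := N j.+1 t; set k := hp j.+1.
have k0 : 0 < k by exact: hp0.
rewrite -/n (hpS j) -/k in a1 a2; rewrite -/n' -/k in b1 b2.
have l1 : (n.*2 <= n')%N.
  by apply: (nat_le k0); rewrite -muln2 natrM -mulrA (le_lt_trans a1).
have l2 : (n' <= n.*2.+1)%N.
  apply: (nat_le k0); rewrite -[in n.*2.+1%:R]natr1 -muln2 natrM mulrDl mul1r.
  by rewrite (le_lt_trans b1)//; lra.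
have hb : ae P (fun w => nrm (U j.+1 t x - iter n.*2 (J k) x) w <= k * nrm (A x) w).
  by apply: iterJ_near => //; rewrite -/n' l1.
have ha := iterJ_half n k0 D2x; rewrite -(hpS j) in ha.
have hc := nrm_distC M (iter n (J (hp j)) x) (iter n.*2 (J k) x).
have hd := ae_and (rnorm_ge0 M (A x)) (rnorm_ge0 M (A (A x))).
apply: filterS3 (nrm_dist_tri M (iter n.*2 (J k) x) (U j.+1 t x) (U j t x))
  (ae_and hb hd) (ae_and ha hc) => w h1 [h2 [p q]] [h3 h4].
rewrite -h4 in h1.
have e1 : n%:R * k ^+ 2 <= t * k by rewrite expr2; nra.
have e2 := ler_wpM2r q e1.
rewrite -[2^-1 ^+ j]/(hp j) hpS -/k.
have p1 := mulr_ge0 (ltW k0) p; have q1 := mulr_ge0 (ltW k0) q.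
have p2 := mulr_ge0 t0 p1; have q2 := mulr_ge0 t0 q1.
apply: le_trans h1 _; move: h2 h3 e2; rewrite /U -/n -/n' -/k => h2 h3 e2.
by move: h2 h3 e2 p1 q1 p2 q2; rewrite ?mulrA; lra.
Qed.

Let U_cvg t x : 0 <= t -> exists y, rlim \oo (fun j => U j t x) y.
Proof.
move=> t0; apply: (contr_dense_cvg (U := U^~ t) HC D2_dense) => // {}x D2x.
apply: (RNcomplete_ratio HC (q := fun=> 2^-1)
  (c := fun w => (1 + t) * (nrm (A (A x)) w + nrm (A x) w))).
- exact: measurable_cst.
- by apply: measurable_funM => //; apply: measurable_funD; exact: rnorm_meas.
- by apply: aeW => w; rewrite invr_ge0 ler0n /= invf_lt1//; lra.
- apply: filterS2 (rnorm_ge0 M (A x)) (rnorm_ge0 M (A (A x))) => w p q.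
  by rewrite mulr_ge0// addr_ge0.
by move=> j; exact: U_step.
Qed.

(** For [t >= 0] the limit exists by [U_cvg], so the default [0] is never taken there. *)
Definition exp_semigroup t x := xget 0 [set y | rlim \oo (fun j => U j t x) y].
Local Notation T := exp_semigroup.

Let T_lim t x : 0 <= t -> rlim \oo (fun j => U j t x) (T t x).
Proof. by move=> t0; have := xgetPex 0 (U_cvg x t0). Qed.

Lemma exp_contr t : 0 <= t -> contraction M (T t).
Proof. by move=> t0; apply: (contr_lim (U := U^~ t)) => // x; exact: T_lim. Qed.

Lemma exp0 x : T 0 x = x.
Proof.
apply: (rlim_unique (T_lim x (lexx 0))); apply: rlim_eq (@rlim_cst _ _ _ _ _ M _ \oo _ x).
by apply: nearW => j; rewrite /U /N mul0r truncn0.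
Qed.

Lemma expD s t x : 0 <= s -> 0 <= t -> T s (T t x) = T (s + t) x.
Proof.
move=> s0 t0; have st0 := addr_ge0 s0 t0.
apply: (contr_dense_eq dD (contr_comp (exp_contr s0) (exp_contr t0))
  (exp_contr st0)) => {}x Dx.
have L1 : rlim \oo (fun j => U j s (U j t x)) (T s (T t x)).
  have h1 : rlim \oo (fun j => U j s (U j t x) - U j s (T t x)) 0.
    apply: rlim_le (T_lim x t0); apply: nearW => j.
    by rewrite subr0 -(contrB (cU j s)); exact: contr_le.
  rewrite -[T s (T t x)]add0r; apply: rlim_eq (rlimD h1 (T_lim (T t x) s0)).
  by apply: nearW => j; rewrite subrK.
(* At level j the semigroup law can fail by one step only, since truncation is additive up to 1; on
   the domain that step costs 2^-j |A x|. *)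
have L2 : rlim \oo (fun j => U j (s + t) x - U j s (U j t x)) 0.
  apply: (@rlim_scal0 _ _ _ _ _ M _ _ _ hp (nrm (A x))) => //.
    exact: rnorm_meas.
  apply: nearW => j; rewrite subr0 gtr0_norm//.
  rewrite /U -iterD; apply: iterJ_near => //.
  have /andP[a1 a2] := N_itv j s0; have /andP[b1 b2] := N_itv j t0.
  have /andP[c1 c2] := N_itv j st0.
  apply/andP; split; apply: (nat_le (hp0 j)); rewrite ?natrD ?mulrDl.
    by rewrite (le_lt_trans _ c2)// lerD.
  rewrite -[in (_ + _).+1%:R]natr1 natrD !mulrDl mul1r.
  by rewrite (le_lt_trans c1)//; lra.
apply: (rlim_unique L1).
rewrite -[T (s + t) x]subr0; apply: rlim_eq (rlimB (T_lim x st0) L2).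
by apply: nearW => j; rewrite subKr.
Qed.

Lemma exp_cont x : rlim (0 : R)^'+ (fun t => T t x) x.
Proof.
have hD z t : 0 <= t -> D z -> ae P (fun w => nrm (T t z - z) w <= t * nrm (A z) w).
  move=> t0 Dz; have L : rlim \oo (fun j => U j t z - z) (T t z - z).
    by apply: rlimB; [exact: T_lim|exact: rlim_cst].
  apply: (nrm_lim_le_cst L).
    by apply: measurable_funM; [exact: measurable_cst|exact: rnorm_meas].
  apply: nearW => j; have /andP[n1 _] := N_itv j t0.
  apply: filterS2 (iterJ_close (N j t) (hp0 j) Dz) (rnorm_ge0 M (A z)) => w h p.
  by rewrite (le_trans h)// ler_wpM2r.
have hD' z : D z -> rlim (0 : R)^'+ (fun t => T t z) z.
  move=> Dz; apply: (@rlim_scal0 _ _ _ _ _ M _ _ _ id (nrm (A z))).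
  - exact: rnorm_meas.
  - exact: cvg_at_right_filter.
  apply: filterS (nbhs_right_gt (0 : R)) => t t0.
  by rewrite gtr0_norm//; apply: hD => //; exact: ltW.
apply/rlimP => e e0; have e3 : 0 < e / 3 by rewrite divr_gt0.
have eE : e = e / 3 + (e / 3 + e / 3) by lra.
have /RNdenseP/(_ x _ e3)[z Dz hz] := dD.
have /rlimP/(_ _ e3) := hD' z Dz.
apply: filterS2 (nbhs_right_gt (0 : R)) => t /ltW t0 ht.
have h1 := rdist_contr (exp_contr t0) (x - z).
rewrite (contrB (exp_contr t0)) (rdistC _ x z) in h1.
rewrite [ltRHS]eE; apply: le_lt_trans (rdist_tri M (T t z) _ _) _.
apply: ltrD; first exact: le_lt_trans hz.
apply: le_lt_trans (rdist_tri M z _ _) _.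
exact: ltrD.
Qed.

(** The quadratic Taylor bound survives the limit in j. The rounding of t to n 2^-j contributes a
    multiple of A x of size at most 2^-j, absorbed in the vanishing term of [nrm_lim_le]. *)
Let gen_D2 x : D2 x -> gen M T x (A x).
Proof.
move=> D2x; have [Dx DAx] := D2x.
have h t : 0 < t ->
    ae P (fun w => nrm (T t x - x - t *r A x) w <= t ^+ 2 * nrm (A (A x)) w).
  move=> t0; have t0' := ltW t0.
  have L : rlim \oo (fun j => U j t x - x - t *r A x) (T t x - x - t *r A x).
    apply: rlimB; last exact: rlim_cst.
    by apply: rlimB; [exact: T_lim|exact: rlim_cst].
  have L0 : rlim \oo (fun j => hp j *r A x) 0.
    apply: (@rlim_scal0 _ _ _ _ _ M _ _ _ hp (nrm (A x))) => //.
      exact: rnorm_meas.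
    apply: nearW => j; rewrite subr0.
    by apply: filterS (nrm_rscale M (hp j) (A x)) => w ->.
  apply: (nrm_lim_le L L0 _ (measurable_cst (1 : R))).
    by apply: measurable_funM; [exact: measurable_cst|exact: rnorm_meas].
  apply: nearW => j; have /andP[n1 n2] := N_itv j t0'.
  set n := N j t in n1 n2.
  have -> : U j t x - x - t *r A x =
      (iter n (J (hp j)) x - x - (n%:R * hp j) *r A x) +
      (n%:R * hp j - t) *r A x.
    by rewrite rscaleBl /U -/n; zmod.
  have g1 := iterJ_taylor n (hp0 j) D2x.
  have g2 := ae_and (nrm_rscale M (n%:R * hp j - t) (A x)) (rnorm_ge0 M (A x)).
  have g3 := ae_and (nrm_rscale M (hp j) (A x)) (rnorm_ge0 M (A (A x))).
  have g4 := rnormD M (iter n (J (hp j)) x - x - (n%:R * hp j) *r A x)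
    ((n%:R * hp j - t) *r A x).
  apply: filterS3 (ae_and g1 g2) g3 g4 => w [k1 [k2 k3]] [k4 k5] k6.
  rewrite subr0 mul1r k4 (gtr0_norm (hp0 j)) (le_trans k6)// k2; apply: lerD.
    rewrite (le_trans k1)// ler_wpM2r// lerXn2r// nnegrE ?(ltW t0)//.
    by rewrite mulr_ge0// ltW.
  rewrite ler_wpM2r// ler0_norm ?subr_le0// opprB lerBlDr addrC.
  exact: ltW.
apply: (@rlim_scal0 _ _ _ _ _ M _ _ _ id (nrm (A (A x)))).
- exact: rnorm_meas.
- exact: cvg_at_right_filter.
apply: filterS (nbhs_right_gt (0 : R)) => t t0; rewrite gtr0_norm//.
have -> : dquot M T t x - A x = t^-1 *r (T t x - x - t *r A x).
  by rewrite rscaleBr rscaleA mulVf ?rscale1// lt0r_neq0.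
apply: filterS2 (nrm_rscale M t^-1 (T t x - x - t *r A x)) (h t t0) => w -> p.
rewrite gtr0_norm ?invr_gt0// ler_pdivrMl//.
by rewrite mulrA -expr2.
Qed.

(** J maps the domain of A into that of A^2 and commutes with A, so (J x, J A x) lies in the graph
    and tends to (x, A x); closedness of the generator of [T] concludes. *)
Lemma exp_gen x : D x -> gen M T x (A x).
Proof.
move=> Dx; have h0 n : 0 < n.+1%:R^-1 :> R by rewrite invr_gt0.
apply: (generator_closed exp_contr exp0 expD exp_cont
  (u := fun n => J n.+1%:R^-1 x) (v := fun n => J n.+1%:R^-1 (A x))).
- by move=> n; rewrite -AJ//; apply: gen_D2; exact: J_D2.
- exact: J_lim.
- exact: J_lim.
Qed.

Lemma exp_gen_dom x y : gen M T x y -> D x.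
Proof.
move=> g; pose z := J 1 (x - y).
have Dz : D z by exact: DJ.
have e : z - A z = x - y by rewrite -[RHS](JK _ (@ltr01 R)) rscale1.
suff -> : x = z by [].
have m1 : cmeas (fun=> 1 : R[i]) := @cmeas_cst R d Ω 1.
apply: (gen_inj exp_contr m1 _ g (exp_gen Dz)); last by rewrite !smul1.
by apply: aeW => w; exact: ltr01.
Qed.

End exponential_formula.

(** * The equivalence of generation and resolvent bounds *)

Section Hille_Yosida.
Context (R : realType) (d : measure_display) (Ω : measurableType d)
        (P : probability Ω R) (S : zmodType) (M : RNModule P S).
Variables (D : set S) (A : S -> S).
Hypothesis HC : RNcomplete M.
Local Notation "t *r x" := (rscale M t x) (at level 40).

Lemma semigroup_resolvent T : contraction_C0_semigroup M T ->
  is_generator M T D A ->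
  closed_op M D A /\ RNdense M D /\
  forall xi : Ω -> R[i], cmeas xi -> ae P (fun w => 0 < complex.Re (xi w)) ->
    exists Rxi, is_resolvent M D A xi Rxi /\
      opnorm_le M Rxi (fun w => (complex.Re (xi w))^-1).
Proof.
move=> [[bT [T0 [TD Tc]]] nT] [Dg Ag].
have cT t : 0 <= t -> contraction M (T t).
  by move=> t0; apply: contr_intro; [exact: bT|exact: nT].
have {}Tc x : rlim M (0 : R)^'+ (fun t => T t x) x by exact/lim_right0P.
have D_gen x : D x <-> exists y, gen M T x y.
  rewrite Dg; split=> -[y h]; exists y; first exact/lim_right0P.
  exact/lim_right0P.
have A_gen x : D x -> gen M T x (A x) by move=> Dx; apply/lim_right0P; exact: Ag.
split; first exact: (generator_closed_op cT T0 TD Tc D_gen A_gen).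
split; first exact: (generator_RNdense cT T0 TD Tc HC D_gen).
by move=> xi; exact: (generator_resolvent cT T0 TD Tc HC D_gen A_gen).
Qed.

Lemma resolvent_real (xi : Ω -> R) Q : rmeas xi -> ae P (fun w => 0 < xi w) ->
  opnorm_le M Q (fun w => (xi w)^-1) ->
  opnorm_le M (fun x => smul M (rC xi) (Q x)) (fun=> 1).
Proof.
move=> mxi xi0 hQ; apply: opnorm_le_intro; split; first exact: measurable_cst.
split; first exact: aeW.
move=> x; apply: filterS3 xi0 (rnormZ M (Q x) (cmeas_rC mxi))
  (opnorm_le_bound x hQ) => w p -> h.
by rewrite /rC cabsR gtr0_norm// mul1r -ler_pdivlMl.
Qed.

Lemma resolvent_semigroup : submodule M D -> modhom_on M D A -> RNdense M D ->
  (forall xi : Ω -> R, rmeas xi -> ae P (fun w => 0 < xi w) ->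
     exists Rxi, is_resolvent M D A (rC xi) Rxi /\
       opnorm_le M (fun x => smul M (rC xi) (Rxi x)) (fun=> 1)) ->
  exists T, contraction_C0_semigroup M T /\ is_generator M T D A.
Proof.
move=> HD HA dD hR.
have /choice[Q hQ] : forall h : R, exists Q, 0 < h ->
    is_resolvent M D A (rC (fun=> h^-1)) Q /\
    opnorm_le M (fun x => h^-1 *r Q x) (fun=> 1).
  move=> h; have [h0|h0] := ltP 0 h; last by exists id.
  have [|Q hQ] := hR (fun=> h^-1) (measurable_cst _).
    by apply: aeW => w; rewrite invr_gt0.
  by exists Q.
(* (I - hA)^-1 is h^-1 times the resolvent at the constant h^-1, so the bound in (b) says precisely
   that it is a contraction. *)
pose J h y := h^-1 *r Q h y.
have Dr t x : D x -> D (t *r x).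
  by case: HD => _ [_ DZ] Dx; apply: DZ => //; exact: cmeas_cst.
have Ar t x : D x -> A (t *r x) = t *r A x.
  by case: HA => _ AZ Dx; apply: AZ => //; exact: cmeas_cst.
have cJ h : 0 < h -> contraction M (J h).
  move=> h0; have [[_ [_ [[QD QZ] _]]] nQ] := hQ h h0; split; first split.
  - by move=> x y _ _; rewrite /J QD// rscaleDr.
  - by move=> xi x m _; rewrite /J QZ// smul_rscale.
  by move=> x; apply: filterS (opnorm_le_bound x nQ) => w; rewrite mul1r.
have DJ h y : 0 < h -> D (J h y).
  by move=> h0; have [[_ [Q2 _]] _] := hQ h h0; apply: Dr; case: (Q2 y).
have JK h y : 0 < h -> J h y - h *r A (J h y) = y.
  move=> h0; have [[_ [Q2 _]] _] := hQ h h0; have [DQ QE] := Q2 y.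
  by rewrite /J Ar// rscaleA divff ?lt0r_neq0// rscale1.
have KJ h x : 0 < h -> D x -> J h (x - h *r A x) = x.
  move=> h0 Dx; have [[Q1 [_ [[QD QZ] _]]] _] := hQ h h0.
  have -> : J h (x - h *r A x) = Q h (h^-1 *r (x - h *r A x)).
    by rewrite [RHS]QZ//; exact: cmeas_cst.
  by rewrite rscaleBr rscaleA mulVf ?lt0r_neq0// rscale1; exact: Q1.
pose T := exp_semigroup M J.
have cT t (t0 : 0 <= t) : contraction M (T t) :=
  exp_contr HC HD HA dD cJ DJ JK KJ t0.
exists T; split; first split.
- split; first by move=> t t0; exact/contr_bounded_op/cT.
  split; first by move=> x; exact: (exp0 HC HD HA dD cJ DJ JK KJ).
  split; first by move=> s t x; exact: (expD HC HD HA dD cJ DJ JK KJ).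
  by move=> x; apply/lim_right0P; exact: (exp_cont HC HD HA dD cJ DJ JK KJ).
- by move=> t t0; exact/contr_opnorm_le/cT.
have Ag x : D x -> lim_right0 M (diff_quot M T x) (A x).
  by move=> Dx; apply/lim_right0P; exact: (exp_gen HC HD HA dD cJ DJ JK KJ).
split => // x; split=> [Dx|[y /lim_right0P h]].
  by exists (A x); exact: Ag.
exact: (exp_gen_dom HC HD HA dD cJ DJ JK KJ h).
Qed.

End Hille_Yosida.

Theorem theorem4p4 (R : realType) (d : measure_display) (Ω : measurableType d)
  (P : probability Ω R) (S : zmodType) (M : RNModule P S)
  (Hcomplete : RNcomplete M) (D : set S) (A : S -> S)
  (HD : submodule M D) (HA : modhom_on M D A) :
  let a := exists T : R -> S -> S,
             contraction_C0_semigroup M T /\ is_generator M T D A in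
  let b := closed_op M D A /\ RNdense M D /\
           forall xi : Ω -> R, rmeas xi -> ae P (fun w => 0 < xi w) ->
             exists Rxi, is_resolvent M D A (rC xi) Rxi /\
               opnorm_le M (fun x => smul M (rC xi) (Rxi x)) (fun _ => 1) in
  let c := closed_op M D A /\ RNdense M D /\
           forall xi : Ω -> R[i], cmeas xi ->
             ae P (fun w => 0 < complex.Re (xi w)) ->
             exists Rxi, is_resolvent M D A xi Rxi /\
               opnorm_le M Rxi (fun w => (complex.Re (xi w))^-1) in
  (a <-> b) /\ (a <-> c).
Proof.
move=> a b c.
(* The implications form a cycle (a), (c), (b), (a), where (c) specialises to (b) at real positive
   random variables. *)
have ac : a -> c by move=> [T [cT gT]]; exact: (semigroup_resolvent Hcomplete cT gT).
have cb : c -> b.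
  move=> [Acl [dD hR]]; split=> //; split=> // xi mxi xi0.
  have [Q [rQ nQ]] := hR _ (cmeas_rC mxi) xi0.
  by exists Q; split => //; exact: resolvent_real nQ.
have ba : b -> a by move=> [_ [dD hR]]; exact: (resolvent_semigroup Hcomplete HD HA dD hR).
by split; split => // h; [exact/cb/ac|exact/ba/cb].
Qed.
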